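(* Let $f:(M,Q)\to\mathbb{R}^n$ be isothermic with Christoffel transform $f^c$, let $r\in\mathbb{R}$, let $F_r:M\to SL(\Gamma_n)$ satisfy $$F_r^{-1}dF_r=\begin{pmatrix}0&df\\ r\,df^c&0\end{pmatrix},$$ and set $f_r=F_r\cdot0$, $\hat f_r=F_r\cdot\infty$. For $r\ne0$, $(f_r,\hat f_r)$ are a Darboux pair of isothermic surfaces. Moreover $f_r$ (and so $\hat f_r$) are isothermic with respect to $(M,Q)$ and $$\hat f_r=\mathcal{D}_{-r}f_r .$$
   Context: $C\ell_n$ is the real Clifford algebra of Euclidean $\mathbb{R}^n$, with $vw+wv=-2(v,w)1$; $\Gamma_n\subset C\ell_n^\times$ is the group generated by nonzero vectors; $a\mapsto a^t$ is the anti-involution fixing vectors. $SL(\Gamma_n)$ is the group of matrices $\begin{pmatrix}a&b\\ c&d\end{pmatrix}$ with $a,b,c,d\in\Gamma_n\cup\{0\}$, $ac^t,bd^t,a^tb,c^td\in\mathbb{R}^n$, $ad^t-bc^t=1$, acting on $\mathbb{R}^n\cup\{\infty\}$ by $x\mapsto(ax+b)(cx+d)^{-1}$, $\infty\mapsto ac^{-1}$. For Clifford-valued 1-forms, $(\alpha\wedge\beta)(X,Y)=\alpha(X)\beta(Y)-\alpha(Y)\beta(X)$. A polarised Riemann surface $(M,Q)$ is a Riemann surface with a nonzero holomorphic quadratic differential $Q$. A conformal immersion $f:(M,Q)\to\mathbb{R}^n$ is isothermic if there is $f^c:M\to\mathbb{R}^n$ (the Christoffel transform, unique up to translation) with $df\wedge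 df^c=0$ and $(df,df^c)^{2,0}=Q$, where $(\alpha,\beta)^{2,0}=(\alpha(\partial_z),\beta(\partial_z))dz^2$. Non-constant maps $f,\hat f:M\to\mathbb{R}^n$ with $g=\hat f-f$ nowhere zero form a Darboux pair if $df\wedge g^{-1}d\hat fg^{-1}=0$. For isothermic $f:(M,Q)\to\mathbb{R}^n$ and $s\in\mathbb{R}\setminus\{0\}$, $\hat f=\mathcal{D}_sf$ means $\hat f=f+g$ with $dg=s\,g\,df^c\,g-df$ (products in $C\ell_n$). Statements are local: considered where $f_r,\hat f_r$ are $\mathbb{R}^n$-valued (which may be arranged locally by left multiplying $F_r$ by a constant), and away from the zeros of $Q$ where immersions are required. *)

(* Defs.v *)
From HB Require Import structures.
From mathcomp Require Import all_boot all_order all_algebra.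
From mathcomp Require Import complex ring zify.
From mathcomp Require Import all_classical all_reals all_analysis.

Set Implicit Arguments.
Unset Strict Implicit.
Unset Printing Implicit Defensive.

Import Order.TTheory GRing.Theory Num.Theory.
Import numFieldNormedType.Exports.

Local Open Scope classical_set_scope.
Local Open Scope ring_scope.

Definition dot (K : comNzRingType) (n : nat) (v w : 'rV[K]_n) : K :=
  \sum_i v 0 i * w 0 i.

Section BasisSigns.
Variable n : nat.
Implicit Types S T W : {set 'I_n}.

Definition symdiff S T : {set 'I_n} := [set i | (i \in S) (+) (i \in T)]%SET.

(* For e_S := e_{i_1} ... e_{i_k}, S = {i_1 < ... < i_k}, the Clifford relations
   e_i e_j = - e_j e_i (i != j) and e_i^2 = - 1 give
   e_S e_T = (-1)^(ninv S T) e_(symdiff S T): the pairs j < i count the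
   transpositions needed, the pairs j = i count the squares. *)
Definition ninv S T : nat :=
  #|[set p : 'I_n * 'I_n | [&& p.1 \in S, p.2 \in T & (p.2 <= p.1)%N]]%SET|.

Lemma symdiffA S T W : symdiff S (symdiff T W) = symdiff (symdiff S T) W.
Proof. by apply/setP => i; rewrite !inE addbA. Qed.

Lemma symdiffC S T : symdiff S T = symdiff T S.
Proof. by apply/setP => i; rewrite !inE addbC. Qed.

Lemma symdiffK S T : symdiff S (symdiff S T) = T.
Proof. by apply/setP => i; rewrite !inE addbA addbb. Qed.

Lemma symdiff0 S : symdiff S finset.set0 = S.
Proof. by apply/setP => i; rewrite !inE addbF. Qed.

Lemma odd_ninv S T : odd (ninv S T) =
  \big[addb/false]_(p : 'I_n * 'I_n | (p.2 <= p.1)%N) ((p.1 \in S) && (p.2 \in T)).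
Proof.
rewrite /ninv cardE -sum1_size big_enum_cond /= (big_morph odd oddD (erefl _)).
rewrite big_mkcond [RHS]big_mkcond; apply: eq_bigr => -[i j] _ /=.
by rewrite !inE /= andbA; case: (_ <= _)%N; rewrite ?andbT ?andbF //; case: ifP.
Qed.

Lemma odd_ninvDl S T W :
  odd (ninv (symdiff S T) W) = odd (ninv S W) (+) odd (ninv T W).
Proof.
rewrite !odd_ninv -big_split; apply: eq_bigr => p _ /=.
by rewrite inE andb_addl.
Qed.

Lemma odd_ninvDr S T W :
  odd (ninv S (symdiff T W)) = odd (ninv S T) (+) odd (ninv S W).
Proof.
rewrite !odd_ninv -big_split; apply: eq_bigr => p _ /=.
by rewrite inE andb_addr.
Qed.

Lemma ninv_0l T : ninv finset.set0 T = 0.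
Proof. by apply: eq_card0 => p; rewrite !inE. Qed.

Lemma ninv_0r S : ninv S finset.set0 = 0.
Proof. by apply: eq_card0 => p; rewrite !inE andbF. Qed.

End BasisSigns.

Definition clifford (R : realType) (n : nat) := 'rV[R]_#|{set 'I_n}|.

HB.instance Definition _ (R : realType) (n : nat) :=
  NormedModule.on (clifford R n).

Section CliffordRing.
Variables (R : realType) (n : nat).
Local Notation Cl := (clifford R n).
Implicit Types (a b c : Cl) (S T W : {set 'I_n}).

Definition coef a S : R := a 0 (enum_rank S).
Definition of_coef (g : {set 'I_n} -> R) : Cl := \row_k g (enum_val k).

Lemma of_coefK g : coef (of_coef g) = g.
Proof. by apply/funext => S; rewrite /coef mxE enum_rankK. Qed.

Lemma coefP a b : coef a =1 coef b -> a = b.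
Proof.
move=> ab; apply/rowP => k.
by have := ab (enum_val k); rewrite /coef enum_valK.
Qed.

Definition basis S : Cl := of_coef (fun T => (T == S)%:R).

Definition cl_one : Cl := basis finset.set0.
Definition cl_mul a b : Cl := of_coef (fun W =>
  \sum_S (-1) ^+ ninv S (symdiff S W) * (coef a S * coef b (symdiff S W))).

Lemma coefD a b S : coef (a + b) S = coef a S + coef b S.
Proof. by rewrite /coef mxE. Qed.

Lemma coefZ (k : R) a S : coef (k *: a) S = k * coef a S.
Proof. by rewrite /coef mxE. Qed.

Lemma coef_mul a b W : coef (cl_mul a b) W =
  \sum_S (-1) ^+ ninv S (symdiff S W) * (coef a S * coef b (symdiff S W)).
Proof. by rewrite of_coefK. Qed.


Lemma sign_ninvDl S T W : (-1) ^+ ninv (symdiff S T) W =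
  (-1) ^+ ninv S W * (-1) ^+ ninv T W :> R.
Proof. by rewrite -signr_odd odd_ninvDl signr_addb !signr_odd. Qed.

Lemma sign_ninvDr S T W : (-1) ^+ ninv S (symdiff T W) =
  (-1) ^+ ninv S T * (-1) ^+ ninv S W :> R.
Proof. by rewrite -signr_odd odd_ninvDr signr_addb !signr_odd. Qed.

Lemma cl_mulA : associative cl_mul.
Proof.
move=> a b c; apply: coefP => W; rewrite !coef_mul.
under eq_bigr => S _ do rewrite coef_mul 2!mulr_sumr.
under [RHS]eq_bigr => S _ do rewrite coef_mul mulr_suml mulr_sumr.
rewrite [RHS]exchange_big /=; apply: eq_bigr => S _.
rewrite [RHS](reindex_inj (can_inj (symdiffK S))) /=; apply: eq_bigr => T _.
rewrite symdiffK -symdiffA.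
have -> : symdiff S (symdiff T W) = symdiff T (symdiff S W).
  by rewrite !symdiffA (symdiffC T).
set X := symdiff T (symdiff S W).
have -> : symdiff S W = symdiff T X by rewrite symdiffK.
by rewrite sign_ninvDr sign_ninvDl; ring.
Qed.

Lemma coef_basis S T : coef (basis S) T = (T == S)%:R.
Proof. by rewrite of_coefK. Qed.

Lemma symdiff_eq0 S T : (symdiff S T == finset.set0) = (S == T).
Proof.
apply/eqP/eqP => [ST|->]; first by rewrite -(symdiffK S T) ST symdiff0.
by apply/setP => i; rewrite !inE addbb.
Qed.

Lemma cl_mul1 : left_id cl_one cl_mul.
Proof.
move=> a; apply: coefP => W; rewrite coef_mul.
rewrite (bigD1 finset.set0) //= big1 ?addr0 => [|S /negbTE nS].
  by rewrite coef_basis eqxx symdiffC symdiff0 ninv_0l expr0 !mul1r.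
by rewrite coef_basis nS mul0r mulr0.
Qed.

Lemma cl_mulr1 : right_id cl_one cl_mul.
Proof.
move=> a; apply: coefP => W; rewrite coef_mul.
rewrite (bigD1 W) //= big1 ?addr0 => [|S /negbTE nS].
  have -> : symdiff W W = finset.set0 by apply/eqP; rewrite symdiff_eq0.
  by rewrite coef_basis eqxx ninv_0r expr0 mul1r mulr1.
by rewrite coef_basis symdiff_eq0 nS !mulr0.
Qed.

Lemma cl_mulDl : left_distributive cl_mul +%R.
Proof.
move=> a b c; apply: coefP => W; rewrite coefD !coef_mul -big_split /=.
by apply: eq_bigr => S _; rewrite coefD; ring.
Qed.

Lemma cl_mulDr : right_distributive cl_mul +%R.
Proof.
move=> a b c; apply: coefP => W; rewrite coefD !coef_mul -big_split /=.
by apply: eq_bigr => S _; rewrite coefD; ring.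
Qed.

Lemma coef0 S : coef 0 S = 0.
Proof. by rewrite /coef mxE. Qed.

Lemma cl_one_neq0 : cl_one != 0.
Proof.
apply/eqP => /(congr1 (coef ^~ finset.set0)) /eqP.
by rewrite coef_basis eqxx coef0 oner_eq0.
Qed.

HB.instance Definition _ := GRing.Zmodule_isNzRing.Build Cl
  cl_mulA cl_mul1 cl_mulr1 cl_mulDl cl_mulDr cl_one_neq0.

Lemma coefM a b W : coef (a * b) W =
  \sum_S (-1) ^+ ninv S (symdiff S W) * (coef a S * coef b (symdiff S W)).
Proof. exact: coef_mul. Qed.

Lemma cl_scaleAl (k : R) a b : k *: (a * b) = k *: a * b.
Proof.
apply: coefP => W; rewrite coefZ !coefM mulr_sumr.
by apply: eq_bigr => S _; rewrite coefZ; ring.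
Qed.

HB.instance Definition _ := GRing.Lmodule_isLalgebra.Build R Cl cl_scaleAl.

Lemma cl_scaleAr (k : R) a b : k *: (a * b) = a * (k *: b).
Proof.
apply: coefP => W; rewrite coefZ !coefM mulr_sumr.
by apply: eq_bigr => S _; rewrite coefZ; ring.
Qed.

HB.instance Definition _ := GRing.Lalgebra_isAlgebra.Build R Cl cl_scaleAr.

Definition has_inv (a : Cl) : Prop := exists b, b * a = 1 /\ a * b = 1.
Definition cl_unit : pred Cl := fun a => `[< has_inv a >].
Definition cl_inv a : Cl :=
  if pselect (has_inv a) is left ex then projT1 (cid ex) else a.

Lemma cl_mulVr : {in cl_unit, left_inverse 1 cl_inv *%R}.
Proof.
move=> a /asboolP ua; rewrite /cl_inv; case: pselect => // ex.
by case: (cid ex) => b /= [].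
Qed.

Lemma cl_mulrV : {in cl_unit, right_inverse 1 cl_inv *%R}.
Proof.
move=> a /asboolP ua; rewrite /cl_inv; case: pselect => // ex.
by case: (cid ex) => b /= [].
Qed.

Lemma cl_unitP a b : b * a = 1 /\ a * b = 1 -> cl_unit a.
Proof. by move=> ab; apply/asboolP; exists b. Qed.

Lemma cl_inv_out : {in [predC cl_unit], cl_inv =1 id}.
Proof.
move=> a; rewrite inE /= /cl_inv; case: pselect => // ex.
by rewrite unfold_in; move/asboolP.
Qed.

HB.instance Definition _ := GRing.NzRing_hasMulInverse.Build Cl
  cl_mulVr cl_mulrV cl_unitP cl_inv_out.

Lemma basisM S T :
  basis S * basis T = (-1) ^+ ninv S T *: basis (symdiff S T).
Proof.
apply: coefP => W; rewrite coefM coefZ coef_basis.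
rewrite (bigD1 S) //= big1 ?addr0 => [|V /negbTE nV]; last first.
  by rewrite coef_basis nV mul0r mulr0.
rewrite !coef_basis eqxx mul1r.
have -> : (symdiff S W == T) = (W == symdiff S T).
  by apply/eqP/eqP => [<-|->]; rewrite symdiffK.
by case: eqP => [->|_]; rewrite ?symdiffK ?mulr0.
Qed.

Definition vec (v : 'rV[R]_n) : Cl := \sum_i v 0 i *: basis [set i]%SET.

Definition is_vec a : Prop := exists v, a = vec v.

(* Reversing e_{i_1} ... e_{i_k} takes 'C(k, 2) transpositions. *)
Definition transp a : Cl := of_coef (fun S => (-1) ^+ 'C(#|S|, 2) * coef a S).

Lemma ninv1 (i j : 'I_n) : ninv [set i]%SET [set j]%SET = (j <= i)%N.
Proof.
rewrite /ninv; case: (leqP j i) => ji /=; last first.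
  apply: eq_card0 => -[k l]; rewrite !inE /=.
  by apply/negbTE/and3P => -[/eqP-> /eqP->]; rewrite leqNgt ji.
rewrite -(cards1 (i, j)); apply: eq_card => -[k l]; rewrite !inE /= xpair_eqE.
by apply/and3P/andP => [[-> ->]//|[/eqP-> /eqP->]]; rewrite !eqxx.
Qed.

Lemma basis1_anticomm (i j : 'I_n) :
  basis [set i]%SET * basis [set j]%SET + basis [set j]%SET * basis [set i]%SET =
  (- ((i == j)%:R *+ 2)) *: 1.
Proof.
rewrite !basisM !ninv1 (symdiffC [set j]%SET) -scalerDl.
case: eqVneq => [->|ij].
  have -> : symdiff [set j]%SET [set j]%SET = finset.set0.
    by apply/eqP; rewrite symdiff_eq0.
  by rewrite leqnn expr1 mulr2n opprD.
have : (i != j :> nat) by [].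
by rewrite neq_ltn => /orP[] h; rewrite (ltnW h) leqNgt h /= expr0 expr1;
  rewrite ?subrr ?addNr ?mul0rn ?oppr0 !scale0r.
Qed.

Lemma vec_anticomm (v w : 'rV[R]_n) :
  vec v * vec w + vec w * vec v = (- (dot v w *+ 2)) *: 1.
Proof.
rewrite /vec !mulr_suml.
under eq_bigr do rewrite mulr_sumr.
under [X in _ + X = _]eq_bigr do rewrite mulr_sumr.
rewrite [X in _ + X = _]exchange_big -big_split /=.
under eq_bigr => i _.
  rewrite -big_split /= (bigD1 i) //= big1 ?addr0 => [|j ji].
  rewrite -!scalerAl -!scalerAr !scalerA (mulrC (w 0 i)) -scalerDr basis1_anticomm eqxx scalerA.
  over.
  rewrite -!scalerAl -!scalerAr !scalerA (mulrC (w 0 j)) -scalerDr basis1_anticomm.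
  by rewrite eq_sym (negbTE ji) mul0rn oppr0 scale0r scaler0.
rewrite -scaler_suml; congr (_ *: _); rewrite /dot -sumrMnl -sumrN.
by apply: eq_bigr => i _; rewrite mulrN mulrnAr mulr1.
Qed.

Lemma transp_vec (v : 'rV[R]_n) : transp (vec v) = vec v.
Proof.
apply: coefP => S; rewrite of_coefK.
have -> : coef (vec v) S = \sum_i v 0 i * coef (basis [set i]%SET) S.
  by rewrite /coef /vec summxE; apply: eq_bigr => i _; rewrite mxE.
rewrite mulr_sumr; apply: eq_bigr => i _; rewrite coef_basis.
by case: eqP => [->|_]; rewrite ?cards1 ?mul1r ?mulr0.
Qed.

Lemma ninv_swap S T :
  (ninv S T + ninv T S = #|S| * #|T| + #|S :&: T|%SET)%N.
Proof.
pose A := [set p : 'I_n * 'I_n | [&& p.1 \in S, p.2 \in T & (p.2 <= p.1)%N]]%SET.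
pose B := [set p : 'I_n * 'I_n | [&& p.1 \in S, p.2 \in T & (p.1 <= p.2)%N]]%SET.
have -> : ninv T S = #|B|.
  have swapI : injective (fun p : 'I_n * 'I_n => (p.2, p.1)).
    by move=> [i j] [k l] [-> ->].
  rewrite /ninv -(card_imset B swapI).
  apply: eq_card => -[i j]; rewrite inE /=; apply/idP/imsetP => [/and3P[iT jS ji]|].
    by exists (j, i) => //; rewrite inE /= iT jS ji.
  by case=> -[k l]; rewrite inE /= => /and3P[kS lT kl] [-> ->]; apply/and3P.
rewrite -[ninv S T]/#|A| -cardsUI -cardsX; congr (_ + _)%N.
  apply: eq_card => -[i j]; rewrite !inE /=.
  by case: (i \in S); case: (j \in T) => //=; exact: leq_total.
rewrite -(card_imset (S :&: T)%SET (f := fun i => (i, i))); last by move=> i j [].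
apply: eq_card => -[i j]; rewrite !inE /=; apply/idP/imsetP.
  move=> /andP[/and3P[iS jT ji] /and3P[_ _ ij]].
  have e : i = j by apply/val_inj/anti_leq; rewrite ij ji.
  by exists i; rewrite ?e // inE -{1}e iS jT.
by case=> k; rewrite inE => /andP[kS kT] [-> ->]; rewrite kS kT leqnn.
Qed.

Lemma odd_ninv_symdiff S T :
  odd 'C(#|symdiff S T|, 2) (+) odd (ninv S T) =
  odd (ninv T S) (+) (odd 'C(#|T|, 2) (+) odd 'C(#|S|, 2)).
Proof.
have binD x y : 'C(x + y, 2) = ('C(x, 2) + 'C(y, 2) + x * y)%N.
  by elim: x => [|x IH]; rewrite ?add0n ?addn0 // addSn !binS IH !bin1; lia.
have card_symdiff : (#|symdiff S T| + #|S :&: T|%SET.*2 = #|S| + #|T|)%N.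
  rewrite -addnn -(cardsUI S T) addnA; congr (_ + _)%N.
  rewrite -cardsUI -[RHS]addn0; congr (_ + _)%N.
    by apply: eq_card => i; rewrite !inE; case: (i \in S); case: (i \in T).
  by apply: eq_card0 => i; rewrite !inE; case: (i \in S); case: (i \in T).
have := congr1 odd (ninv_swap S T); have := congr1 (fun m => odd 'C(m, 2)) card_symdiff.
rewrite !binD -addnn binD !oddD !oddM oddD !addbb andbF addbF addFb -/(_ && _) andbb.
move: (odd 'C(#|symdiff S T|, 2)) (odd #|S :&: T|%SET) (odd 'C(#|S|, 2))
  (odd 'C(#|T|, 2)) (odd (ninv S T)) (odd (ninv T S)) (odd #|S|) (odd #|T|).
by do 8!case.
Qed.

Lemma transpM a b : transp (a * b) = transp b * transp a.
Proof.
apply: coefP => W; rewrite of_coefK !coefM mulr_sumr.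
have symdiffKr : cancel (fun S => symdiff S W) (fun S => symdiff S W).
  by move=> S; rewrite (symdiffC S) symdiffC symdiffK.
rewrite [RHS](reindex_inj (can_inj symdiffKr)) /=.
apply: eq_bigr => S _; rewrite !of_coefK.
set T := symdiff S W.
have -> : symdiff T W = S by exact: symdiffKr.
have -> : W = symdiff S T by rewrite symdiffK.
have := congr1 (fun t : bool => (-1) ^+ t : R) (odd_ninv_symdiff S T).
rewrite !signr_addb !signr_odd => e.
rewrite !mulrA e; ring.
Qed.

End CliffordRing.

Section Vahlen.
Variables (R : realType) (n : nat).
Local Notation Cl := (clifford R n).

Inductive Gamma : Cl -> Prop :=
| Gamma_vec v : v != 0 -> Gamma (vec v)
| Gamma_one : Gamma 1
| Gamma_mul a b : Gamma a -> Gamma b -> Gamma (a * b)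
| Gamma_inv a : Gamma a -> Gamma a^-1.

Definition mx2 (a b c d : Cl) : 'M[Cl]_2 :=
  \matrix_(i, j) if i == 0 then (if j == 0 then a else b)
                 else (if j == 0 then c else d).

Definition SLGamma (g : 'M[Cl]_2) : Prop :=
  let: (a, b, c, d) := (g 0 0, g 0 1, g 1 0, g 1 1) in
  [/\ forall i j, Gamma (g i j) \/ g i j = 0,
      is_vec (a * transp c), is_vec (b * transp d),
      is_vec (transp a * b) & is_vec (transp c * d)] /\
  a * transp d - b * transp c = 1.

(* The graph of the action: moebius g x y means g . x = y, where None is the
   point at infinity. *)
Definition moebius (g : 'M[Cl]_2) (x y : option 'rV[R]_n) : Prop :=
  let num := if x is Some v then g 0 0 * vec v + g 0 1 else g 0 0 in
  let den := if x is Some v then g 1 0 * vec v + g 1 1 else g 1 0 in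
  if y is Some w then den != 0 /\ vec w = num / den else den = 0.

End Vahlen.

Section Plane.
Variable R : realType.

Fixpoint Ck (V : normedModType R) (k : nat) (D : set (R * R)) (h : R * R -> V)
    : Prop :=
  if k is k'.+1 then
    (forall z, D z -> differentiable h z) /\ (forall v, Ck k' D ('D_v h))
  else forall z, D z -> {for z, continuous h}.

Definition smooth (V : normedModType R) (D : set (R * R)) (h : R * R -> V) :=
  forall k, Ck k D h.

(* The plane R * R is the complex line, (x, y) standing for x + iy. *)
Definition to_complex (z : R * R) : R[i] := Complex z.1 z.2.
Definition of_complex (w : R[i]) : R * R := (complex.Re w, complex.Im w).
Definition mulI (z : R * R) : R * R := (- z.2, z.1).

Definition holomorphic (D : set (R * R)) (h : R * R -> R * R) : Prop :=
  smooth D h /\ forall z, D z -> forall v, 'D_(mulI v) h z = mulI ('D_v h z).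

Definition complex_derivative (h : R * R -> R * R) (z : R * R) : R[i] :=
  to_complex ('D_(1, 0) h z).

End Plane.

(* Connectedness is not required, so that every open subset of a Riemann surface
   is one.  The inverse chart param i only matters on chart i @` dom i. *)
Record riemann_surface (R : realType) := RiemannSurface {
  points :> topologicalType;
  points_hausdorff : hausdorff_space points;
  chart_index : Type;
  dom : chart_index -> set points;
  chart : chart_index -> points -> R * R;
  param : chart_index -> R * R -> points;
  dom_open : forall i, open (dom i);
  dom_cover : forall p, exists i, dom i p;
  chart_open : forall i, open (chart i @` dom i);
  chartK : forall i p, dom i p -> param i (chart i p) = p;
  chart_continuous : forall i p, dom i p -> {for p, continuous (chart i)};
  param_continuous : forall i z, (chart i @` dom i) z ->
    {for z, continuous (param i)};
  transition_holomorphic : forall i j,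
    holomorphic (chart i @` (dom i `&` dom j)) (chart j \o param i)
}.

Arguments dom {R} _ _ _.
Arguments chart {R} _ _ _.
Arguments param {R} _ _ _.

(* In the chart z = chart i the differential is qcoef i (z) dz^2. *)
Record quadratic_differential (R : realType) (M : riemann_surface R) :=
  QuadraticDifferential {
  qcoef : chart_index M -> R * R -> R[i];
  qcoef_holomorphic : forall i,
    holomorphic (chart M i @` dom M i) (@of_complex R \o qcoef i);
  qcoef_transition : forall i j p, dom M i p -> dom M j p ->
    qcoef i (chart M i p) = qcoef j (chart M j p) *
      complex_derivative (chart M j \o param M i) (chart M i p) ^+ 2
}.

Arguments qcoef {R M} _ _ _.

Section Surfaces.
Variables (R : realType) (M : riemann_surface R).
Implicit Types (U V : set M) (Q : quadratic_differential M).

Definition nonvanishing_at Q (p : M) : Prop :=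
  exists i, dom M i p /\ qcoef Q i (chart M i p) != 0.

(* (U, Q) is polarised: Q does not vanish identically on U. *)
Definition polarised U Q : Prop := exists2 p, U p & nonvanishing_at Q p.

Definition locally (P : set M -> Prop) U : Prop :=
  forall p, U p -> exists V, [/\ open V, V p, V `<=` U & P V].

Definition smooth_on (W : normedModType R) U (h : M -> W) : Prop :=
  forall i, smooth (chart M i @` (dom M i `&` U)) (h \o param M i).

(* The differential of h at p, as a linear map on the coordinate plane of the
   chart i. *)
Definition dif (W : normedModType R) i (h : M -> W) (p : M) (X : R * R) : W :=
  'D_X (h \o param M i) (chart M i p).

End Surfaces.

Section Isothermic.
Variables (R : realType) (n : nat) (M : riemann_surface R).
Local Notation Cl := (clifford R n).
Implicit Types (U V : set M) (Q : quadratic_differential M).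
Implicit Types (f : M -> 'rV[R]_n).

Definition wedge (alpha beta : R * R -> Cl) (X Y : R * R) : Cl :=
  alpha X * beta Y - alpha Y * beta X.

(* The differential of f as a Clifford-valued 1-form. *)
Definition cdif i f (p : M) (X : R * R) : Cl := vec (dif i f p X).

(* The value on d/dz = (d/dx - i d/dy) / 2 of the complex-linear extension of a
   1-form. *)
Definition on_dz (alpha : R * R -> 'rV[R]_n) : 'rV[R[i]]_n :=
  \row_k (2^-1 * ((alpha (1, 0) 0 k)%:C - 'i * (alpha (0, 1) 0 k)%:C))%C.

(* dot, on C^n, is the complex-bilinear extension of the inner product. *)
Definition pairing20 (alpha beta : R * R -> 'rV[R]_n) : R[i] :=
  dot (on_dz alpha) (on_dz beta).

Definition conformal_immersion U f : Prop :=
  smooth_on U f /\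
  forall i p, dom M i p -> U p -> exists2 lambda : R, 0 < lambda &
    forall X Y, dot (dif i f p X) (dif i f p Y) =
      lambda * (X.1 * Y.1 + X.2 * Y.2).

Definition christoffel U Q f fc : Prop :=
  smooth_on U fc /\
  forall i p, dom M i p -> U p ->
    (forall X Y, wedge (cdif i f p) (cdif i fc p) X Y = 0) /\
    pairing20 (dif i f p) (dif i fc p) = qcoef Q i (chart M i p).

Definition isothermic_with U Q f fc : Prop :=
  conformal_immersion U f /\ christoffel U Q f fc.

Definition isothermic U Q f : Prop := exists fc, isothermic_with U Q f fc.

Definition nonconstant_on U f : Prop :=
  exists p q, [/\ U p, U q & f p != f q].

Definition darboux_pair U f fhat : Prop :=
  [/\ smooth_on U f, smooth_on U fhat, nonconstant_on U f,
      nonconstant_on U fhat & forall p, U p -> fhat p - f p != 0] /\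
  forall i p, dom M i p -> U p -> let g := vec (fhat p - f p) in
    forall X Y,
      wedge (cdif i f p) (fun Z => g^-1 * cdif i fhat p Z * g^-1) X Y = 0.

(* fhat = D_s f on U. *)
Definition darboux_transform U Q (s : R) f fhat : Prop :=
  [/\ s != 0, smooth_on U fhat & exists fc, isothermic_with U Q f fc /\
    forall i p, dom M i p -> U p -> let g := vec (fhat p - f p) in
      forall X, cdif i (fun q => fhat q - f q) p X =
        s *: (g * cdif i fc p X * g) - cdif i f p X].

(* F^-1 dF = omega at p, evaluated on X. *)
Definition log_derivative_is i (F : M -> 'M[Cl]_2) (p : M) (X : R * R)
    (omega : 'M[Cl]_2) : Prop :=
  exists Finv : 'M[Cl]_2, [/\ Finv *m F p = 1%:M, F p *m Finv = 1%:M &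
    Finv *m (\matrix_(k, l) dif i (fun q => F q k l) p X) = omega].

End Isothermic.

(* Main.v *)
(* Write F = (a b; c d) and e^-t for the inverse of e^t.  Differentiating
   f_r d = b and fhat_r c = a with the structure equations for F gives
     df_r = d^-t df d^-1,  dfhat_r = - r c^-t df^c c^-1,
     fhat_r - f_r = d^-t c^-1 = c^-t d^-1.
   Since e e^t is a nonzero scalar for e in the Clifford group, df_r is
   conformal, and d df^c d^t is R^n-valued.  From dd = c df and df /\ df^c = 0 it
   is closed, hence locally the differential of a Christoffel transform of f_r,
   with the same (2,0)-pairing Q; the formula for fhat_r - f_r turns
   dfhat_r into - r g df_r^c g.  The same argument applies to fhat_r with
   (c, f^c, f) in place of (d, f, f^c), as f^c is itself conformal and immersed
   away from the zeros of Q. *)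
Require Import Defs.
From HB Require Import structures.
From mathcomp Require Import all_boot all_order all_algebra.
From mathcomp Require Import complex ring lra.
From mathcomp Require Import all_classical all_reals all_analysis.

Set Implicit Arguments.
Unset Strict Implicit.
Unset Printing Implicit Defensive.

Import Order.TTheory GRing.Theory Num.Theory.
Import numFieldNormedType.Exports.

Local Open Scope classical_set_scope.
Local Open Scope ring_scope.

(** * Differentiability and smoothness in the plane *)

(** The pivot is the formula e^-t = m^-1 e, valid when e e^t = m. It turns d^-t df d^-1 into a
    multiple of d df d^t, so f_r and its Christoffel transform come from df and df^c by one and the
    same map v -> d v d^t. That map multiplies lengths by |m|, and in the (2,0)-pairing the powers
    of m cancel, so that Q comes back exactly. Differentiating d and d^t in d df^c d^t produces c
    (df /\ df^c) d^t and, up to sign, its reversal d (df^c /\ df) c^t. Transposition fixes vectors,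
    so the second wedge vanishes with the first. What remains cancels by symmetry of second
    derivatives, and a primitive comes from the Poincare lemma; both are proved here from the mean
    value theorem and differentiation under the integral. The sign in D_{-r} comes from the
    determinant condition: it reads (a - f_r c) d^t = 1 at the point 0 but (b - fhat_r d) c^t = -1
    at infinity. For fhat_r the roles of f and f^c are exchanged. Conformality of f^c is pure
    algebra, and it is an immersion off the zeros of Q because df^c = 0 at a point would force Q = 0
    there. *)

Section Differentiability.
Context {R : realType} {V W : normedModType R}.

(** Later proofs of differentiability start from explicit estimates with a candidate differential;
    this trades the little-o form for such an inequality. *)
Lemma differentiable_epsP (f : V -> W) (x : V) (L : {linear V -> W}) :
  continuous L ->
  (forall e : R, 0 < e ->
    \forall h \near (0 : V), `|f (h + x) - f x - L h| <= e * `|h|) ->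
  differentiable f x /\ forall v, 'D_v f x = L v.
Proof.
move=> cL Lf.
have fL : f \o shift x = cst (f x) + L +o_ 0 id.
  apply/eqaddoP => e e0; have := Lf e e0; apply: filterS => h /=.
  by rewrite fctE /= /cst opprD addrA.
have dL : 'd f x = L :> (V -> W) by exact: diff_unique.
have df : differentiable f x by apply/diff_locallyP; rewrite dL.
by split => // v; rewrite deriveE// dL.
Qed.

Lemma differentiable_eps (f : V -> W) (x : V) : differentiable f x ->
  forall e : R, 0 < e ->
    \forall h \near (0 : V), `|f (h + x) - f x - 'd f x h| <= e * `|h|.
Proof.
move=> /diff_locallyP[_ /eqaddoP fx] e e0; have := fx e e0.
by apply: filterS => h /=; rewrite fctE /= /cst opprD addrA.
Qed.

Lemma near_eq_differentiable (f g : V -> W) (x : V) :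
  (\forall y \near x, f y = g y) -> differentiable f x -> differentiable g x.
Proof.
move=> fg df.
suff [] : differentiable g x /\ forall v, 'D_v g x = 'd f x v by [].
apply: differentiable_epsP => [|e e0]; first exact: diff_continuous.
have fgx : f x = g x by exact: nbhs_singleton fg.
have fg0 : \forall h \near (0 : V), f (h + x) = g (h + x).
  by move: fg; rewrite (near_shift 0); apply: filterS => h /=; rewrite subr0.
near=> h; rewrite -fgx -(near fg0 h)//.
by near: h; exact: differentiable_eps.
Unshelve. all: by end_near. Qed.

Lemma derive_comp_linear (X : normedModType R) (f : V -> W) (L : {linear W -> X})
    (x : V) : continuous L -> differentiable f x ->
  differentiable (L \o f) x /\ forall v, 'D_v (L \o f) x = L ('D_v f x).
Proof.
move=> cL df; have dL : differentiable L (f x) by exact: linear_differentiable.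
have dLf := differentiable_comp df dL.
by split => // v; rewrite !deriveE// diff_comp//= diff_lin.
Qed.

End Differentiability.

Section LinearRow.
Variable R : realType.

Lemma linear_row_continuous (m : nat) (X : normedModType R)
  (L : {linear 'rV[R]_m -> X}) : continuous L.
Proof.
move=> v; have -> : L = \sum_j (fun w : 'rV[R]_m => w 0 j *: L (delta_mx 0 j)) :> (_ -> _).
  by apply/funext => w; rewrite [in LHS](row_sum_delta w) linear_sum fct_sumE;
     apply: eq_bigr => j _; rewrite linearZ.
apply/differentiable_continuous/differentiable_sum => j.
apply: differentiableZl; exact: differentiable_coord.
Qed.

End LinearRow.

Section CkCalculus.
Variable R : realType.
Implicit Types (D : set (R * R)) (V W : normedModType R) (k : nat).

Lemma Ck_sub V k D D' (h : R * R -> V) : D' `<=` D -> Ck k D h -> Ck k D' h.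
Proof.
move=> DD'; elim: k h => [|k IH] h /=; first by move=> ch z /DD'/ch.
by move=> [dh ch]; split=> [z /DD'/dh//|v]; exact: IH.
Qed.

Lemma open_near_eq V D (h h' : R * R -> V) z : open D -> D z ->
  (forall y, D y -> h y = h' y) -> \forall y \near z, h y = h' y.
Proof.
by move=> oD Dz hh'; apply: filterS (open_nbhs_nbhs (conj oD Dz)) => y /hh'.
Qed.

(** Openness turns agreement on [D] into agreement near each point, which is what derivatives
    see. *)
Lemma Ck_eq V k D (h h' : R * R -> V) : open D ->
  (forall z, D z -> h z = h' z) -> Ck k D h -> Ck k D h'.
Proof.
move=> oD; elim: k h h' => [|k IH] h h' hh' /=.
  move=> ch z Dz; have hz := open_near_eq oD Dz hh'.
  suff : h' x @[x --> z] --> h' z by [].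
  rewrite -(hh' z Dz).
  by apply: cvg_trans (ch z Dz); exact: near_eq_cvg.
move=> [dh ch]; split=> [z Dz|v].
  by apply: near_eq_differentiable (dh z Dz); exact: open_near_eq hh'.
apply: IH (ch v) => z Dz.
by apply: near_eq_derive; exact: open_near_eq hh'.
Qed.

Lemma CkS V k D (h : R * R -> V) : Ck k.+1 D h -> Ck k D h.
Proof.
elim: k h => [|k IH] h [dh ch]; first by move=> z /dh/differentiable_continuous.
by split=> // v; exact/IH/ch.
Qed.

Lemma Ck_cst V k D (w : V) : Ck k D (fun=> w).
Proof.
elim: k w => [|k IH] w; first by move=> z _; exact: cvg_cst.
split=> [z _|v]; first exact: differentiable_cst.
by rewrite (_ : 'D_v _ = fun=> 0)//; apply/funext => z; rewrite derive_cst.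
Qed.

Lemma Ck_add V k D (h g : R * R -> V) : open D -> Ck k D h -> Ck k D g ->
  Ck k D (fun z => h z + g z).
Proof.
move=> oD; elim: k h g => [|k IH] h g /=.
  by move=> ch cg z Dz; apply: cvgD; [exact: ch|exact: cg].
move=> [dh ch] [dg cg]; split=> [z Dz|v].
  exact: (differentiableD (dh z Dz) (dg z Dz)).
apply: Ck_eq (IH _ _ (ch v) (cg v)) => // z Dz.
by rewrite [RHS]deriveD//; apply: diff_derivable; [exact: dh|exact: dg].
Qed.

Lemma Ck_sum V (I : Type) (s : seq I) k D (h : I -> R * R -> V) : open D ->
  (forall i, Ck k D (h i)) -> Ck k D (fun z => \sum_(i <- s) h i z).
Proof.
move=> oD ch; elim: s => [|i s IH].
  by under eq_fun do rewrite big_nil; exact: Ck_cst.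
by under eq_fun do rewrite big_cons; exact: Ck_add.
Qed.

Lemma Ck_mul k D (h g : R * R -> R) : open D -> Ck k D h -> Ck k D g ->
  Ck k D (fun z => h z * g z).
Proof.
move=> oD; elim: k h g => [|k IH] h g.
  by move=> ch cg z Dz; apply: cvgM; [exact: ch|exact: cg].
move=> Ch Cg; have [dh ch] := Ch; have [dg cg] := Cg; split=> [z Dz|v].
  exact: (differentiableM (dh z Dz) (dg z Dz)).
apply: (@Ck_eq _ _ _ (fun z => h z * 'D_v g z + g z * 'D_v h z)) => // [z Dz|].
  by rewrite [RHS]deriveM//; apply: diff_derivable; [exact: dh|exact: dg].
(* Leibniz pairs a derivative with an undifferentiated factor; [CkS] lowers the latter to the level
   of the induction hypothesis. *)
by apply: Ck_add => //; [exact: IH (CkS Ch) (cg v)|exact: IH (CkS Cg) (ch v)].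
Qed.

Lemma Ck_inv k D (h : R * R -> R) : open D -> (forall z, D z -> h z != 0) ->
  Ck k D h -> Ck k D (fun z => (h z)^-1).
Proof.
move=> oD h0; elim: k => [|k IH] Ch.
  by move=> z Dz; exact: (cvgV (h0 z Dz) (Ch z Dz)).
have [dh ch] := Ch; split=> [z Dz|v].
  by exact: (differentiableV (dh z Dz) (h0 z Dz)).
apply: (@Ck_eq _ _ _ (fun z => (- 1) * ((h z)^-1 * (h z)^-1) * 'D_v h z)) => // [z Dz|].
  rewrite [RHS]deriveV ?h0//; last by apply: diff_derivable; exact: dh.
  by rewrite mulN1r -expr2 exprVn.
have iC := IH (CkS Ch).
by apply: (Ck_mul oD _ (ch v)); apply: (Ck_mul oD); [exact: Ck_cst|exact: (Ck_mul oD)].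
Qed.

Lemma Ck_linear (m : nat) V k D (L : {linear 'rV[R]_m -> V})
  (h : R * R -> 'rV[R]_m) : open D -> Ck k D h -> Ck k D (fun z => L (h z)).
Proof.
move=> oD; have cL : continuous L by exact: linear_row_continuous.
elim: k h => [|k IH] h.
  by move=> ch z Dz; apply: (cvg_comp _ _ (ch z Dz)); exact: cL.
move=> [dh ch]; split=> [z Dz|v]; first exact: (derive_comp_linear cL (dh z Dz)).1.
apply: Ck_eq (IH _ (ch v)) => // z Dz.
by rewrite [RHS](derive_comp_linear cL (dh z Dz)).2.
Qed.

(** Named so that the coordinate functional can carry a linear structure and be an argument of
    [Ck_linear]. *)
Definition row_entry (m : nat) (j : 'I_m) (v : 'rV[R]_m) : R := v 0 j.

Lemma row_entry_is_linear m (j : 'I_m) : linear (row_entry j).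
Proof. by move=> a u v; rewrite /row_entry !mxE. Qed.

HB.instance Definition _ m (j : 'I_m) :=
  GRing.isLinear.Build R 'rV[R]_m R _ (row_entry j) (row_entry_is_linear j).

Lemma differentiable_row (m : nat) V (h : V -> 'rV[R]_m) z :
  (forall j, differentiable (fun y => h y 0 j) z) -> differentiable h z.
Proof.
move=> dh; have -> : h = \sum_j (fun y => h y 0 j *: delta_mx 0 j).
  by apply/funext => y; rewrite fct_sumE [LHS]row_sum_delta.
by apply: differentiable_sum => j; exact: differentiableZl.
Qed.

Lemma derive_coord (m : nat) V (h : V -> 'rV[R]_m) z v j : differentiable h z ->
  differentiable (fun y => h y 0 j) z /\
  'D_v (fun y => h y 0 j) z = 'D_v h z 0 j.
Proof.
move=> dh; have cj : continuous (row_entry j) by exact: linear_row_continuous.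
by have [d1 d2] := derive_comp_linear cj dh; split; [|exact: d2].
Qed.

Lemma Ck_row (m k : nat) D (h : R * R -> 'rV[R]_m) : open D ->
  (forall j, Ck k D (fun z => h z 0 j)) -> Ck k D h.
Proof.
move=> oD; elim: k h => [|k IH] h ch.
  have hE y : h y = \sum_j h y 0 j *: delta_mx 0 j by exact: row_sum_delta.
  apply: (Ck_eq oD (fun z _ => esym (hE z))); apply: Ck_sum => // j z Dz.
  by apply: cvgZr_tmp; exact: (ch j z Dz).
have dh z : D z -> differentiable h z.
  by move=> Dz; apply: differentiable_row => j; exact: (ch j).1.
split=> // v; apply: IH => j; apply: Ck_eq ((ch j).2 v) => // z Dz.
exact: (derive_coord _ _ (dh z Dz)).2.
Qed.

Lemma Ck_coord (m k : nat) D (h : R * R -> 'rV[R]_m) j : open D ->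
  Ck k D h -> Ck k D (fun z => h z 0 j).
Proof. by move=> oD; exact: (Ck_linear (row_entry j)). Qed.

Lemma smooth_derive V D (h : R * R -> V) v : smooth D h -> smooth D ('D_v h).
Proof. by move=> sh k; exact: (sh k.+1).2. Qed.

Lemma smooth_differentiable V D (h : R * R -> V) z :
  smooth D h -> D z -> differentiable h z.
Proof. by move=> sh; exact: (sh 1%N).1. Qed.

Lemma smoothP V D (h : R * R -> V) : (forall z, D z -> differentiable h z) ->
  (forall v, smooth D ('D_v h)) -> smooth D h.
Proof.
move=> dh sh [|k]; first by move=> z /dh/differentiable_continuous.
by split=> // v; exact: sh.
Qed.

End CkCalculus.

(** * Mixed partial derivatives and the Poincare lemma *)

Section PlaneCurl.
Variable R : realType.
Local Notation ex := ((1, 0) : R * R).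
Local Notation ey := ((0, 1) : R * R).
Implicit Types (D : set (R * R)) (V : normedModType R).

Lemma is_derive_fst V (h : R * R -> V) x y : differentiable h (x, y) ->
  is_derive x 1 (fun t => h (t, y)) ('D_(1, 0) h (x, y)).
Proof.
move=> dh0; have dh : derivable h (x, y) (1, 0) by exact: diff_derivable.
have e : (fun s : R => s^-1 *: (((fun t => h (t, y)) \o shift x) (s *: (1 : R)) - h (x, y)))
       = (fun s => s^-1 *: ((h \o shift (x, y)) (s *: (1, 0)) - h (x, y))).
  apply/funext => s /=; congr (_ *: (h _ - _)).
  by congr pair; rewrite /= ?scaler0 ?add0r.
by split; [rewrite /derivable e|rewrite /derive e].
Qed.

Lemma is_derive_snd V (h : R * R -> V) x y : differentiable h (x, y) ->
  is_derive y 1 (fun t => h (x, t)) ('D_(0, 1) h (x, y)).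
Proof.
move=> dh0; have dh : derivable h (x, y) (0, 1) by exact: diff_derivable.
have e : (fun s : R => s^-1 *: (((fun t => h (x, t)) \o shift y) (s *: (1 : R)) - h (x, y)))
       = (fun s => s^-1 *: ((h \o shift (x, y)) (s *: (0, 1)) - h (x, y))).
  apply/funext => s /=; congr (_ *: (h _ - _)).
  by congr pair; rewrite /= ?scaler0 ?add0r.
by split; [rewrite /derivable e|rewrite /derive e].
Qed.

Lemma derivable_itv_continuous (f df : R -> R) (a b : R) :
  (forall x, a <= x <= b -> is_derive x 1 f (df x)) ->
  {within `[a, b], continuous f}.
Proof.
by move=> fd; apply: derivable_within_continuous => x; rewrite in_itv /= => /fd[].
Qed.

Lemma MVT_is_derive (f df : R -> R) (a b : R) : a < b ->
  (forall x, a <= x <= b -> is_derive x 1 f (df x)) ->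
  exists2 c, a < c < b & f b - f a = df c * (b - a).
Proof.
move=> ab fd; have [c cab fE] := MVT ab
  (fun x xab => fd x (subset_itv_oo_cc xab)) (derivable_itv_continuous fd).
by exists c; rewrite // -in_itv.
Qed.

(** Increments of either sign, including zero, occur in [differentiable_partials]; hence a mean
    value theorem without an order on the endpoints. *)
Lemma MVT_unordered (f df : R -> R) (a b d : R) : `|b - a| < d ->
  (forall x, `|x - a| < d -> is_derive x 1 f (df x)) ->
  exists2 c, `|c - a| <= `|b - a| & f b - f a = df c * (b - a).
Proof.
move=> bad fd; case: (ltgtP a b) => ab; last first.
- by exists a; rewrite ab !subrr ?mulr0// normr0.
- have [||c /andP[bc ca] fE] := @MVT_is_derive f df b a => //.
    move=> x /andP[bx xa]; apply: fd; rewrite ltr_norml; move: bad.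
    by rewrite ltr_norml => /andP[]; lra.
  exists c; last by rewrite -opprB fE -mulrN opprB.
  by rewrite !ler0_norm; lra.
- have [||c /andP[ac cb] fE] := @MVT_is_derive f df a b => //.
    move=> x /andP[ax xb]; apply: fd; rewrite ltr_norml; move: bad.
    by rewrite ltr_norml => /andP[]; lra.
  by exists c; rewrite // !ger0_norm; lra.
Qed.

(** The mean value theorem is applied in the first variable to the difference of the two horizontal
    edges, then to [h1] in the second variable. The curried form allows reuse with the variables
    exchanged. *)
Lemma second_difference (h h1 h12 : R -> R -> R) (x y s : R) : 0 < s ->
  (forall a b, x <= a <= x + s -> y <= b <= y + s ->
     is_derive a 1 (fun t => h t b) (h1 a b)) ->
  (forall a b, x <= a <= x + s -> y <= b <= y + s ->
     is_derive b 1 (h1 a) (h12 a b)) ->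
  exists a b, [/\ x < a < x + s, y < b < y + s &
    h (x + s) (y + s) - h (x + s) y - (h x (y + s) - h x y) = s * s * h12 a b].
Proof.
move=> s0 hd h1d.
have [||a xas hE] := @MVT_is_derive (fun t => h t (y + s) - h t y)
    (fun t => h1 t (y + s) - h1 t y) x (x + s) => //; first by lra.
  by move=> t xts; apply: is_deriveB; apply: hd => //; lra.
have [||b ybs h1E] := @MVT_is_derive (h1 a) (h12 a) y (y + s) => //; first by lra.
  by move=> t yts; apply: h1d => //; lra.
by exists a, b; split => //; rewrite hE h1E; ring.
Qed.

Lemma near_box z (P : R * R -> Prop) : (\forall y \near z, P y) ->
  exists2 r : R, 0 < r & forall a b, `|a - z.1| < r -> `|b - z.2| < r -> P (a, b).
Proof.
move=> /nbhs_ballP[r r0 rD]; exists r => // a b az bz; apply: rD.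
by split => /=; rewrite -ball_normE /= distrC.
Qed.

Lemma open_box D z : open D -> D z -> exists2 r : R, 0 < r &
  forall a b, `|a - z.1| < r -> `|b - z.2| < r -> D (a, b).
Proof. by move=> oD Dz; apply: near_box; exact: open_nbhs_nbhs. Qed.

Lemma continuous_box (h : R * R -> R) z (e : R) : {for z, continuous h} -> 0 < e ->
  exists2 r : R, 0 < r &
  forall a b, `|a - z.1| < r -> `|b - z.2| < r -> `|h z - h (a, b)| < e.
Proof.
move=> ch e0; apply: (@near_box z (fun y => `|h z - h y| < e)).
by move/cvgrPdist_lt : ch; exact.
Qed.

(** Schwarz's theorem: one second difference over a small square, computed in both orders, equates
    [h12] and [h21] at two possibly different points near [z]; continuity moves both points to
    [z]. *)
Lemma mixed_partials D (h h1 h2 h12 h21 : R * R -> R) z : open D -> D z ->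
  (forall a b, D (a, b) -> is_derive a 1 (fun t => h (t, b)) (h1 (a, b))) ->
  (forall a b, D (a, b) -> is_derive b 1 (fun t => h (a, t)) (h2 (a, b))) ->
  (forall a b, D (a, b) -> is_derive b 1 (fun t => h1 (a, t)) (h12 (a, b))) ->
  (forall a b, D (a, b) -> is_derive a 1 (fun t => h2 (t, b)) (h21 (a, b))) ->
  {for z, continuous h12} -> {for z, continuous h21} -> h12 z = h21 z.
Proof.
move=> oD Dz dh1 dh2 dh12 dh21 c12 c21.
apply/eqP; rewrite -subr_eq0 -normr_le0; apply/ler_addgt0Pl => /= e e0; rewrite addr0.
have e2 : 0 < e / 2 by rewrite divr_gt0.
have [r1 r10 D1] := open_box oD Dz.
have [r2 r20 D2] := continuous_box c12 e2.
have [r3 r30 D3] := continuous_box c21 e2.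
pose r := Order.min r1 (Order.min r2 r3); pose s := r / 2.
have r_le : [/\ r <= r1, r <= r2 & r <= r3] by rewrite !ge_min !lexx ?orbT.
have r0 : 0 < r by rewrite !lt_min r10 r20.
have s0 : 0 < s by rewrite divr_gt0.
have sr : s < r by rewrite /s; lra.
have small (c a : R) : c <= a <= c + s -> `|a - c| < r.
  by move=> ?; rewrite ltr_norml; lra.
have [r_1 r_2 r_3] := r_le.
have hD a b : z.1 <= a <= z.1 + s -> z.2 <= b <= z.2 + s -> D (a, b).
  by move=> /small az /small bz; apply: D1; lra.
have [||a [b [az bz E12]]] := @second_difference (fun a b => h (a, b))
    (fun a b => h1 (a, b)) (fun a b => h12 (a, b)) z.1 z.2 s s0.
- by move=> a b az bz; apply: dh1; exact: hD.
- by move=> a b az bz; apply: dh12; exact: hD.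
have [||b' [a' [bz' az' E21]]] := @second_difference (fun b a => h (a, b))
    (fun b a => h2 (a, b)) (fun b a => h21 (a, b)) z.2 z.1 s s0.
- by move=> b' a' bz' az'; apply: dh2; exact: hD.
- by move=> b' a' bz' az'; apply: dh21; exact: hD.
have E : h12 (a, b) = h21 (a', b').
  have ss0 : s * s != 0 by rewrite mulf_neq0// gt_eqF.
  by apply: (mulfI ss0); rewrite -E12 -E21; ring.
have small' (c d : R) : c < d < c + s -> `|d - c| < r.
  by move=> ?; apply: small; lra.
have H1 : `|h12 z - h12 (a, b)| < e / 2.
  by apply: D2; [have := small' _ _ az|have := small' _ _ bz]; lra.
have H2 : `|h21 z - h21 (a', b')| < e / 2.
  by apply: D3; [have := small' _ _ az'|have := small' _ _ bz']; lra.
have -> : h12 z - h21 z = (h12 z - h12 (a, b)) - (h21 z - h21 (a', b')).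
  by rewrite E; ring.
by apply: le_trans (ler_normB _ _) _; rewrite ltW//; lra.
Qed.

Lemma derive_swap D (h : R * R -> R) z : open D -> smooth D h -> D z ->
  'D_ey ('D_ex h) z = 'D_ex ('D_ey h) z.
Proof.
move=> oD sh Dz; have s1 := smooth_derive ex sh; have s2 := smooth_derive ey sh.
apply: (@mixed_partials D h ('D_ex h) ('D_ey h) ('D_ey ('D_ex h)) ('D_ex ('D_ey h)) z oD Dz).
- by move=> a b Dab; exact: is_derive_fst (smooth_differentiable sh Dab).
- by move=> a b Dab; exact: is_derive_snd (smooth_differentiable sh Dab).
- by move=> a b Dab; exact: is_derive_snd (smooth_differentiable s1 Dab).
- by move=> a b Dab; exact: is_derive_fst (smooth_differentiable s2 Dab).
- exact: (smooth_derive ey s1 0%N z Dz).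
- exact: (smooth_derive ex s2 0%N z Dz).
Qed.

Definition plane_form (p q : R) (v : R * R) : R := v.1 * p + v.2 * q.

Lemma plane_form_is_linear p q : linear (plane_form p q).
Proof.
by move=> k [u1 u2] [v1 v2]; rewrite /plane_form /= /GRing.scale /=; ring.
Qed.

HB.instance Definition _ p q := GRing.isLinear.Build R (R * R)%type R _
  (plane_form p q) (plane_form_is_linear p q).

(** The increment is split into a horizontal move at height y + v and a vertical move at abscissa x.
    The mean value theorem on each leg replaces it by a nearby value of [P] or [Q], each within e /
    2 of its value at [z]. *)
Lemma differentiable_partials (H P Q : R * R -> R) (z : R * R) (r : R) : 0 < r ->
  (forall a b, `|a - z.1| < r -> `|b - z.2| < r ->
     is_derive a 1 (fun t => H (t, b)) (P (a, b)) /\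
     is_derive b 1 (fun t => H (a, t)) (Q (a, b))) ->
  {for z, continuous P} -> {for z, continuous Q} ->
  differentiable H z /\ forall v, 'D_v H z = v.1 * P z + v.2 * Q z.
Proof.
move=> r0 Hd cP cQ.
apply: (@differentiable_epsP _ _ _ H z (plane_form (P z) (Q z))).
  move=> v; rewrite /continuous_at /plane_form /=; apply: cvgD; apply: cvgMr_tmp.
    exact: cvg_fst.
  exact: cvg_snd.
move=> e e0; have e2 : 0 < e / 2 by rewrite divr_gt0.
have [r1 r10 D1] := continuous_box cP e2.
have [r2 r20 D2] := continuous_box cQ e2.
pose s := Order.min r (Order.min r1 r2).
have [s_0 s_1 s_2] : [/\ s <= r, s <= r1 & s <= r2] by rewrite !ge_min !lexx ?orbT.
have s0 : 0 < s by rewrite !lt_min r0 r10.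
apply/nbhs_ballP; exists s => // -[u v] [/=]; rewrite -!ball_normE /= !sub0r !normrN => us vs.
rewrite /plane_form /=; case: z Hd cP cQ D1 D2 => x y /= Hd _ _ D1 D2.
have sm (c t w : R) : `|t - c| <= `|w| -> `|w| < s -> `|t - c| < s.
  by move=> h1 h2; exact: le_lt_trans h1 h2.
have [||t tx E1] := @MVT_unordered (fun t => H (t, y + v)) (fun t => P (t, y + v)) x (x + u) s.
- by rewrite addrC addKr.
- move=> t tx; apply: (Hd _ _ _ _).1; first by lra.
  by rewrite addrC addKr; lra.
have [||t' ty E2] := @MVT_unordered (fun t => H (x, t)) (fun t => Q (x, t)) y (y + v) s.
- by rewrite addrC addKr.
- move=> t' ty; apply: (Hd _ _ _ _).2; last by lra.
  by rewrite subrr normr0.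
move: E1 E2 tx ty; rewrite ![_ + u]addrC ![_ + v]addrC !addrK => E1 E2 tx ty.
have -> : H (u + x, v + y) - H (x, y) - (u * P (x, y) + v * Q (x, y)) =
    - (u * (P (x, y) - P (t, v + y)) + v * (Q (x, y) - Q (x, t'))).
  by have -> : H (u + x, v + y) = P (t, v + y) * u + (Q (x, t') * v + H (x, y));
    [rewrite -E1 -E2|]; ring.
rewrite normrN; apply: le_trans (ler_normD _ _) _; rewrite !normrM.
have N1 : `|u| <= `|(u, v)| by rewrite prod_normE /= le_max lexx.
have N2 : `|v| <= `|(u, v)| by rewrite prod_normE /= le_max lexx orbT.
rewrite (splitr e) mulrDl; apply: lerD.
  rewrite mulrC ler_pM// ltW//; apply: D1; first by have := sm _ _ _ tx us; lra.
  by rewrite addrK; lra.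
rewrite mulrC ler_pM// ltW//; apply: D2; first by rewrite subrr normr0.
by have := sm _ _ _ ty vs; lra.
Qed.

End PlaneCurl.

(** * Primitives of closed 1-forms on a box of the plane *)

Section Poincare.
Variable R : realType.
Local Notation ex := ((1, 0) : R * R).
Local Notation ey := ((0, 1) : R * R).
Local Notation mu := (@lebesgue_measure R).

Lemma integrable_itv (g : R -> R) (a b : R) :
  {within `[a, b], continuous g} -> mu.-integrable `[a, b] (EFin \o g).
Proof. by move=> cg; apply: continuous_compact_integrable => //; exact: segment_compact. Qed.

Lemma is_derive_integral (g : R -> R) (a b x : R) : a < x < b ->
  (forall t, a <= t <= b -> {for t, continuous g}) ->
  is_derive x 1 (fun y => \int[mu]_(t in `[a, y]) g t)%R (g x).
Proof.
move=> /andP[ax xb] cg.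
have ig : mu.-integrable `[a, b] (EFin \o g).
  apply/integrable_itv/continuous_in_subspaceT => t.
  by rewrite inE /= in_itv /= => /cg.
have [|d1 d2] := continuous_FTC1_closed xb ig ax; first by apply: cg; lra.
by split; [exact: d1|rewrite -derive1E; exact: d2].
Qed.

Lemma integral_derive (G g : R -> R) (a b : R) : a < b ->
  (forall t, a <= t <= b -> is_derive t 1 G (g t)) ->
  (forall t, a <= t <= b -> {for t, continuous g}) ->
  (\int[mu]_(t in `[a, b]) g t)%R = G b - G a.
Proof.
move=> ab dG cg; have cG t : a <= t <= b -> {for t, continuous G}.
  by move=> /dG[dGt _]; apply/differentiable_continuous/derivable1_diffP.
rewrite /Rintegral (continuous_FTC2 (F := G)) //.
- apply/continuous_in_subspaceT => t; by rewrite inE /= in_itv /= => /cg.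
- split=> [t||].
  + by rewrite in_itv /= => /andP[at_ tb]; have [] := dG t; [lra|].
  + by apply: cvg_at_right_filter; apply: cG; lra.
  + by apply: cvg_at_left_filter; apply: cG; lra.
- move=> t; rewrite in_itv /= => /andP[at_ tb]; rewrite derive1E.
  by have [|_ ->] := dG t; [lra|].
Qed.

(* The primitive integrates P along the bottom edge and then Q upwards; the
   partial derivative in x is obtained by differentiating under the integral. *)
Lemma poincare_box (D : set (R * R)) (P Q : R * R -> R) (a u b w K : R) :
  smooth D P -> smooth D Q ->
  (forall x y, a <= x <= u -> b <= y <= w -> D (x, y)) ->
  (forall z, D z -> 'D_ey P z = 'D_ex Q z) ->
  (forall x y, a <= x <= u -> b <= y <= w -> `|'D_ex Q (x, y)| <= K) ->
  exists H : R * R -> R, forall x y, a < x < u -> b < y < w ->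
    is_derive x 1 (fun t => H (t, y)) (P (x, y)) /\
    is_derive y 1 (fun t => H (x, t)) (Q (x, y)).
Proof.
move=> sP sQ hD closed QK.
have cfst (h : R * R -> R) x y : smooth D h -> a <= x <= u -> b <= y <= w ->
    {for x, continuous (fun t => h (t, y))}.
  move=> sh xau ybw; apply/differentiable_continuous/derivable1_diffP.
  by have [] := is_derive_fst (smooth_differentiable sh (hD x y xau ybw)).
have csnd (h : R * R -> R) x y : smooth D h -> a <= x <= u -> b <= y <= w ->
    {for y, continuous (fun t => h (x, t))}.
  move=> sh xau ybw; apply/differentiable_continuous/derivable1_diffP.
  by have [] := is_derive_snd (smooth_differentiable sh (hD x y xau ybw)).
pose A x := (\int[mu]_(t in `[a, x]) P (t, b))%R.
pose B x y := (\int[mu]_(t in `[b, y]) Q (x, t))%R.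
exists (fun z => A z.1 + B z.1 z.2) => x y xau ybw /=.
have bw : b < w by lra.
have b_in : b <= b <= w by lra.
have dA : is_derive x 1 A (P (x, b)).
  apply: (@is_derive_integral (fun t => P (t, b)) a u) => // t tau.
  exact: (cfst P).
split; last first.
  have dB : is_derive y 1 (B x) (Q (x, y)).
    apply: (@is_derive_integral (fun t => Q (x, t)) b w) => // t tbw.
    by apply: (csnd Q) => //; lra.
  by rewrite -[Q (x, y)]add0r; apply: is_deriveD.
have dB : is_derive x 1 (B^~ y) (P (x, y) - P (x, b)).
  pose I : set R := [set` `]a, u[]; pose J : set R := [set` `[b, y]].
  have xin x' : I x' -> a < x' < u by rewrite /I /= in_itv.
  have yin t : J t -> b <= t <= w.
    by rewrite /J /= in_itv /= => tby; lra.
  have intQ x' : I x' -> mu.-integrable J (EFin \o (fun t => Q (x', t))).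
    move=> /xin xau'; apply/integrable_itv/continuous_in_subspaceT => t.
    by rewrite inE => /yin tbw; apply: (csnd Q) => //; lra.
  have dQ x' t : I x' -> J t ->
      is_derive x' 1 (fun s => Q (s, t)) ('D_ex Q (x', t)).
    move=> /xin xau' /yin tbw; apply: is_derive_fst.
    by apply: (smooth_differentiable sQ); apply: hD => //; lra.
  have xI : I x by rewrite /I /= in_itv.
  have K0 : 0 <= K.
    by apply: le_trans (normr_ge0 _) (QK x y _ _); lra.
  have iK : mu.-integrable J (EFin \o (fun=> K)).
    by apply/integrable_itv/continuous_subspaceT => t; exact: cvg_cst.
  have pE x' t : I x' -> J t ->
      partial1of2 (fun s t => Q (s, t)) x' t = 'D_ex Q (x', t).
    by move=> x'I tI; rewrite partial1of2E; have [_ ->] := dQ x' t x'I tI.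
  have dQ' x' t : I x' -> J t -> derivable (fun s => Q (s, t)) x' 1.
    by move=> x'I tI; have [] := dQ x' t x'I tI.
  have Kb x' t : I x' -> J t ->
      `|partial1of2 (fun s t => Q (s, t)) x' t| <= K.
    move=> x'I tI; rewrite pE//; apply: QK; last exact: yin.
    by have := xin _ x'I; lra.
  have mB : measurable J by exact: measurable_itv.
  (* The constant [K] is the integrable function dominating the x-derivative of [Q]. *)
  have dE := @differentiation_under_integral R _ _ mu (fun s t => Q (s, t)) J mB x a u xI
    intQ dQ' (fun=> K) (fun=> K0) iK Kb.
  have dd := @derivable_under_integral R _ _ mu (fun s t => Q (s, t)) J mB x a u xI
    intQ dQ' (fun=> K) (fun=> K0) iK Kb.
  split; first exact: dd.
  rewrite -derive1E [LHS]dE.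
  (* Closedness replaces the x-derivative of [Q] by the y-derivative of [P], whose integral is P (x,
     y) - P (x, b); the last term cancels against the derivative of [A]. *)
  transitivity (\int[mu]_(t in J) 'D_ey P (x, t))%R.
    apply: eq_Rintegral => t; rewrite inE => tI; rewrite pE//.
    by rewrite closed//; apply: hD; [lra|exact: yin].
  apply: (@integral_derive (fun t => P (x, t))) => [|t tby|t tby]; first by lra.
    apply: is_derive_snd; apply: (smooth_differentiable sP); apply: hD; lra.
  by apply: (csnd _ _ _ (smooth_derive ey sP)); lra.
have -> : P (x, y) = P (x, b) + (P (x, y) - P (x, b)) by ring.
exact: is_deriveD.
Qed.

(** [poincare_box] is used coordinate by coordinate, on one box that serves all coordinates. *)
Lemma poincare_row (n : nat) (D : set (R * R)) (A B : R * R -> 'rV[R]_n) z0 :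
  open D -> D z0 -> smooth D A -> smooth D B ->
  (forall z, D z -> 'D_ey A z = 'D_ex B z) ->
  exists (E : set (R * R)) (H : R * R -> 'rV[R]_n), [/\ open E, E z0, E `<=` D &
    forall z, E z -> differentiable H z /\
      forall v, 'D_v H z = v.1 *: A z + v.2 *: B z].
Proof.
move=> oD Dz0 sA sB closed.
pose dB := 'D_ex B.
have sdB : smooth D dB by exact: smooth_derive.
have [r1 r10 D1] := open_box oD Dz0.
have /near_box[r2 r20 D2] : \forall z \near z0, `|dB z0 - dB z| < 1.
  by have /cvgrPdist_lt := sdB 0%N z0 Dz0; apply; exact: ltr01.
(* Halving keeps the closed box of radius [r] inside [D] and inside the region where [dB] differs
   from [dB z0] by less than 1. This yields the dominating constant [|dB z0| + 1]. *)
pose r : R := Order.min r1 r2 / 2.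
have r0 : 0 < r by rewrite divr_gt0// lt_min r10.
have [r_1 r_2] : r < r1 /\ r < r2.
  have : Order.min r1 r2 <= r1 by rewrite ge_min lexx.
  have : Order.min r1 r2 <= r2 by rewrite ge_min lexx orbT.
  by move: r0; rewrite /r; lra.
have sm (c t : R) : c - r <= t <= c + r -> `|t - c| <= r.
  by move=> ct; rewrite ler_norml; lra.
have hD x y : z0.1 - r <= x <= z0.1 + r -> z0.2 - r <= y <= z0.2 + r -> D (x, y).
  by move=> /sm xr /sm yr; apply: D1; lra.
have coefE (h : R * R -> 'rV[R]_n) z v j : smooth D h -> D z ->
    'D_v (fun y => h y 0 j) z = 'D_v h z 0 j.
  by move=> sh Dz; exact: (derive_coord _ _ (smooth_differentiable sh Dz)).2.
have sc (h : R * R -> 'rV[R]_n) j : smooth D h -> smooth D (fun z => h z 0 j).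
  by move=> sh k; exact: Ck_coord.
have HH j : exists H : R * R -> R, forall x y,
    z0.1 - r < x < z0.1 + r -> z0.2 - r < y < z0.2 + r ->
    is_derive x 1 (fun t => H (t, y)) (A (x, y) 0 j) /\
    is_derive y 1 (fun t => H (x, t)) (B (x, y) 0 j).
  apply: (@poincare_box D (fun z => A z 0 j) (fun z => B z 0 j) _ _ _ _ (`|dB z0| + 1)) => //.
  - exact: sc.
  - exact: sc.
  - by move=> z Dz; rewrite !coefE// closed.
  - move=> x y xr yr; rewrite coefE//; last exact: hD.
    have : `|dB z0 - dB (x, y)| < 1.
      by apply: D2; [have := sm _ _ xr|have := sm _ _ yr]; lra.
    have : `|dB (x, y) 0 j| <= `|dB (x, y)|.
      by rewrite [leRHS]/Num.Def.normr/= mx_normrE; exact: (le_bigmax _ _ (0, j)).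
    have := ler_normB (dB z0) (dB z0 - dB (x, y)); rewrite subKr.
    move=> h1 h2 h3; change (`|dB (x, y) 0 j| <= `|dB z0| + 1).
    by apply: (le_trans h2); apply: (le_trans h1); rewrite lerD2l ltW.
have {HH} [H HH] := choice HH.
pose E : set (R * R) := ball z0 r.
have inE' z : E z -> (z0.1 - r < z.1 < z0.1 + r) /\ (z0.2 - r < z.2 < z0.2 + r).
  move=> [/=]; rewrite -!ball_normE /= ![`|_ - z.1|]distrC ![`|_ - z.2|]distrC !ltr_norml.
  by move=> ? ?; split; lra.
have ED : E `<=` D by move=> [x y] /inE'[/= ? ?]; apply: hD; lra.
exists E, (fun z => \row_j H j z); split => //.
- exact: ball_open.
- exact: ballxx.
move=> z Ez; have [z1 z2] := inE' _ Ez.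
have dH j : differentiable (H j) z /\ forall v, 'D_v (H j) z = v.1 * A z 0 j + v.2 * B z 0 j.
  have [s s0 Ds] : exists2 s : R, 0 < s & forall a b, `|a - z.1| < s -> `|b - z.2| < s -> E (a, b).
    by apply: open_box => //; exact: ball_open.
  apply: (@differentiable_partials _ _ (fun z => A z 0 j) (fun z => B z 0 j) _ s) => //.
  - by move=> a b az bz; have [/= ? ?] := inE' _ (Ds a b az bz); exact: HH.
  - by apply: (sc _ _ sA 0%N); exact: ED.
  - by apply: (sc _ _ sB 0%N); exact: ED.
have Hj j : (fun y => (\row_j H j y) 0 j) = H j by apply/funext => y; rewrite mxE.
have dHr : differentiable (fun z => \row_j H j z) z.
  by apply: differentiable_row => j; rewrite Hj; exact: (dH j).1.
split=> // v; apply/rowP => j.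
by rewrite -(derive_coord v j dHr).2 Hj (dH j).2 !mxE.
Qed.

End Poincare.

(** * The Clifford group *)

Section CliffordGroup.
Variables (R : realType) (n : nat).
Local Notation Cl := (clifford R n).
Implicit Types (a b u : Cl) (v w : 'rV[R]_n) (k m : R).

Lemma vec_is_linear : linear (@vec R n : 'rV[R]_n -> Cl).
Proof.
move=> k v w; rewrite /vec scaler_sumr -big_split; apply: eq_bigr => i _.
by rewrite !mxE scalerA scalerDl.
Qed.

HB.instance Definition _ := GRing.isLinear.Build R 'rV[R]_n Cl _ (@vec R n)
  vec_is_linear.

Lemma transp_is_linear : linear (@transp R n : Cl -> Cl).
Proof.
move=> k a b; apply: coefP => S; rewrite Defs.coefD Defs.coefZ !of_coefK Defs.coefD Defs.coefZ.
by ring.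
Qed.

HB.instance Definition _ := GRing.isLinear.Build R Cl Cl _ (@transp R n)
  transp_is_linear.

(** The projection of the algebra onto its vectors. Being linear on all of the algebra, it brings a
    vector-valued Clifford expression back to R^n with smoothness and derivatives intact. *)
Definition unvec a : 'rV[R]_n := \row_i coef a [set i]%SET.

Lemma unvec_is_linear : linear unvec.
Proof. by move=> k a b; apply/rowP => i; rewrite !mxE Defs.coefD Defs.coefZ. Qed.

HB.instance Definition _ := GRing.isLinear.Build R Cl 'rV[R]_n _ unvec
  unvec_is_linear.

Lemma vecK : cancel (@vec R n) unvec.
Proof.
move=> v; apply/rowP => i; rewrite mxE.
have -> : coef (vec v) [set i]%SET = \sum_j v 0 j * coef (Defs.basis R [set j]%SET) [set i]%SET.
  by rewrite /coef /vec summxE; apply: eq_bigr => j _; rewrite mxE.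
rewrite (bigD1 i)//= big1 ?addr0 => [|j ji].
  by rewrite coef_basis eqxx mulr1.
rewrite coef_basis; case: eqP => [/finset.set1_inj ij|_]; last by rewrite mulr0.
by rewrite ij eqxx in ji.
Qed.

Lemma transpK : involutive (@transp R n).
Proof.
move=> a; apply: coefP => S; rewrite !of_coefK mulrA -exprD addnn -mul2n exprM.
by rewrite sqrrN !expr1n mul1r.
Qed.

Lemma transp1 : transp 1 = 1 :> Cl.
Proof.
apply: coefP => S; rewrite of_coefK coef_basis; case: eqP => [->|_]; last by rewrite mulr0.
by rewrite cards0 mul1r.
Qed.

Lemma is_vec_transp a : is_vec a -> transp a = a.
Proof. by move=> [v ->]; exact: transp_vec. Qed.

Lemma alg_inj : injective (fun k => k%:A : Cl).
Proof.
move=> k m /eqP; rewrite -subr_eq0 -scalerBl scaler_eq0 oner_eq0 orbF subr_eq0.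
by move/eqP.
Qed.

Lemma vec_sq v : vec v * vec v = (- dot v v)%:A.
Proof.
have two0 : (2 : R) != 0 by rewrite pnatr_eq0.
apply: (scalerI two0); rewrite scaler_nat mulr2n vec_anticomm scalerA.
by congr (_ *: _); ring.
Qed.

Lemma dot_ge0 v : 0 <= dot v v.
Proof. by apply: sumr_ge0 => i _; rewrite -expr2 sqr_ge0. Qed.

Lemma dot_eq0 v : (dot v v == 0) = (v == 0).
Proof.
rewrite /dot psumr_eq0 => [|i _]; last by rewrite -expr2 sqr_ge0.
apply/allP/eqP => [v0|-> i _]; last by rewrite mxE mul0r eqxx.
apply/rowP => i; have /implyP := v0 i (mem_index_enum i).
by rewrite mulf_eq0 orbb mxE => /(_ isT)/eqP.
Qed.

(* For a product of k vectors, m is (-1)^k times the squared norm. *)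
Definition normed u m := [/\ m != 0, u * transp u = m%:A & transp u * u = m%:A].

Lemma normed_inv u m : normed u m -> [/\ u \is a GRing.unit,
  u^-1 = m^-1 *: transp u & (transp u)^-1 = m^-1 *: u].
Proof.
move=> [m0 uut utu].
have e1 : u * (m^-1 *: transp u) = 1 by rewrite -scalerAr uut scalerA mulVf// scale1r.
have e2 : (m^-1 *: transp u) * u = 1 by rewrite -scalerAl utu scalerA mulVf// scale1r.
have e3 : transp u * (m^-1 *: u) = 1 by rewrite -scalerAr utu scalerA mulVf// scale1r.
have e4 : (m^-1 *: u) * transp u = 1 by rewrite -scalerAl uut scalerA mulVf// scale1r.
have uU : u \is a GRing.unit by apply/unitrP; exists (m^-1 *: transp u).
have utU : transp u \is a GRing.unit by apply/unitrP; exists (m^-1 *: u).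
by split => //; [apply: (mulrI uU)|apply: (mulrI utU)]; rewrite mulrV.
Qed.

Lemma Gamma_normed u : Gamma u -> exists m, normed u m.
Proof.
elim=> [v v0||a b _ [m [m0 am am']] _ [l [l0 bl bl']]|a _ [m am]].
(* A vector is its own transpose and squares to minus its squared length, nonzero since the inner
   product is definite. *)
- exists (- dot v v); rewrite /normed transp_vec vec_sq oppr_eq0.
  by rewrite (_ : dot v v == 0 = (v == 0)) ?dot_eq0.
- by exists 1; rewrite /normed transp1 mulr1 scale1r oner_eq0.
- exists (m * l); split; rewrite ?mulf_neq0// transpM.
    rewrite -mulrA [b * _]mulrA bl -scalerAl mul1r -scalerAr am scalerA.
    by rewrite mulrC.
  by rewrite -mulrA [transp a * _]mulrA am' -scalerAl mul1r -scalerAr bl' scalerA.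
- have [_ aV aV'] := normed_inv am; case: am => m0 am am'.
  exists m^-1; split; rewrite ?invr_neq0// aV linearZ /= transpK -scalerAl -scalerAr.
    by rewrite am' !scalerA mulrAC mulfK.
  by rewrite am !scalerA mulrAC mulfK.
Qed.

Lemma vec_sandwich v w : is_vec (vec v * vec w * vec v).
Proof.
(* For nonzero [v] the witness is |v|^2 times the reflection of [w] in the hyperplane orthogonal to
   [v]. *)
exists (dot v v *: w - (dot v w *+ 2) *: v); rewrite linearB !linearZ /=.
have /(canRL (addrK _)) -> := vec_anticomm v w.
rewrite mulrBl -scalerAl mul1r -mulrA vec_sq -scalerAr mulr1 !scaleNr opprK.
by rewrite addrC scalerN.
Qed.

(** The two orders are proved together because the inverse exchanges them: u^-1 is a multiple of
    u^t. *)
Lemma Gamma_sandwich u : Gamma u ->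
  forall w, is_vec (u * vec w * transp u) /\ is_vec (transp u * vec w * u).
Proof.
elim=> [v v0 w||a b _ IHa _ IHb w|a Ga IHa w].
- by rewrite transp_vec; split; exact: vec_sandwich.
- by move=> w; rewrite transp1 mul1r mulr1; split; exists w.
- rewrite transpM; split.
    have [[w' e] _] := IHb w; have [h _] := IHa w'.
    by rewrite -e !mulrA in h; rewrite !mulrA.
  have [_ [w' e]] := IHa w; have [_ h] := IHb w'.
  by rewrite -e !mulrA in h; rewrite !mulrA.
- have [m am] := Gamma_normed Ga; have [_ -> _] := normed_inv am.
  rewrite linearZ /= transpK -!scalerAl -!scalerAr !scalerA.
  have [[w1 ->] [w2 ->]] := IHa w.
  by split; [exists (m^-1 * m^-1 *: w2)|exists (m^-1 * m^-1 *: w1)]; rewrite linearZ.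
Qed.

Lemma normed_sandwichM u m a b : normed u m ->
  (u * a * transp u) * (u * b * transp u) = m *: (u * (a * b) * transp u).
Proof.
move=> [_ _ um].
by rewrite !mulrA -[u * a * transp u * u]mulrA um -scalerAr mulr1 -!scalerAl.
Qed.

Lemma normed_sandwich1 u m k : normed u m -> u * k%:A * transp u = (k * m)%:A.
Proof. by move=> [_ um _]; rewrite -scalerAr mulr1 -scalerAl um scalerA. Qed.

(** The inner product is read off the anticommutator. One factor [m] comes from the inner u^t u, the
    other from sandwiching the resulting scalar. Separate [k] and [l] are kept so that a surface and
    its Christoffel transform can be scaled differently. *)
Lemma normed_sandwich_dot u m k l v v' w w' : normed u m ->
  vec v' = k *: (u * vec v * transp u) -> vec w' = l *: (u * vec w * transp u) ->
  dot v' w' = k * l * m ^+ 2 * dot v w.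
Proof.
move=> um v'E w'E.
have : (- (dot v' w' *+ 2))%:A = (k * l * m * (- (dot v w *+ 2) * m))%:A :> clifford R n.
  rewrite -vec_anticomm v'E w'E -!scalerAl -!scalerAr !scalerA.
  rewrite !(normed_sandwichM _ _ um) [l * k]mulrC -!scalerDr -mulrDl -mulrDr.
  rewrite vec_anticomm (normed_sandwich1 _ um) !scalerA.
  by congr (_ *: _); rewrite /GRing.scale /=; ring.
move/alg_inj; rewrite !mulr2n => e; apply: (@mulIf _ (2 : R)); first by rewrite pnatr_eq0.
by apply: oppr_inj; rewrite mulr_natr mulr2n e; ring.
Qed.

Lemma normed_sandwich_wedge u m k l a1 a2 b1 b2 a1' a2' b1' b2' : normed u m ->
  a1' = k *: (u * a1 * transp u) -> a2' = k *: (u * a2 * transp u) ->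
  b1' = l *: (u * b1 * transp u) -> b2' = l *: (u * b2 * transp u) ->
  a1 * b2 - a2 * b1 = 0 -> a1' * b2' - a2' * b1' = 0.
Proof.
move=> um -> -> -> -> /eqP; rewrite subr_eq0 => /eqP ab.
rewrite -!scalerAl -!scalerAr !scalerA !(normed_sandwichM _ _ um) ab.
by rewrite subrr.
Qed.

End CliffordGroup.

(** * Algebra of the Christoffel relation and of the (2,0)-pairing *)

Section ChristoffelAlgebra.
Variables (R : realType) (n : nat).
Local Notation Cl := (clifford R n).
Implicit Types (v w : 'rV[R]_n).

Lemma dotC v w : dot v w = dot w v.
Proof. by apply: eq_bigr => i _; rewrite mulrC. Qed.

Lemma dot_lin2 (x y x' y' : R) v w v' w' :
  dot (x *: v + y *: w) (x' *: v' + y' *: w') =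
  x * x' * dot v v' + x * y' * dot v w' + y * x' * dot w v' + y * y' * dot w w'.
Proof.
rewrite /dot !mulr_sumr -!big_split /=; apply: eq_bigr => i _.
by rewrite !mxE; ring.
Qed.

(** Transposition reverses products and fixes vectors; this makes the relation df /\ df^c = 0
    symmetric in f and f^c. *)
Lemma transp_wedge v w v' w' :
  vec v * vec w' - vec v' * vec w = 0 :> Cl -> vec w * vec v' - vec w' * vec v = 0 :> Cl.
Proof.
move=> /(congr1 (@transp R n)); rewrite linearB /= !transpM !transp_vec linear0.
by move/eqP; rewrite subr_eq0 => /eqP->; rewrite subrr.
Qed.

(* Solving for [w2] in [v1 w2 = v2 w1] shows that [w2] is the image of [w1]
   under the quarter turn [v1^-1 v2], so the frame [w1, w2] is conformal too. *)
Lemma christoffel_conformal (v1 v2 w1 w2 : 'rV[R]_n) (l : R) : 0 < l ->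
  dot v1 v1 = l -> dot v2 v2 = l -> dot v1 v2 = 0 ->
  vec v1 * vec w2 - vec v2 * vec w1 = 0 :> Cl ->
  dot w2 w2 = dot w1 w1 /\ dot w1 w2 = 0.
Proof.
move=> l0 v11 v22 v12 /eqP; rewrite subr_eq0 => /eqP e.
have l_neq0 : l != 0 by rewrite gt_eqF.
have et : vec w2 * vec v1 = vec w1 * vec v2 :> Cl.
  by have := congr1 (@transp R n) e; rewrite !transpM !transp_vec.
split.
  have h : vec v1 * (vec w2 * vec w2) * vec v1 = vec v2 * (vec w1 * vec w1) * vec v2 :> Cl.
    by rewrite !mulrA e -[LHS]mulrA et !mulrA.
  move: h; rewrite !vec_sq -!scalerAr !mulr1 -!scalerAl !vec_sq v11 v22 !scalerA.
  by move/alg_inj; rewrite !mulrNN; exact: mulIf.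
(* Multiplying v1 w2 = v2 w1 by v1 on the left and w1 on the right expresses w2 w1 through v1 v2.
   The transposed relation does the same for w1 w2, and the sum is a multiple of the anticommutator
   of v1 and v2, which is 0. *)
have h1 : (- l) *: (vec w2 * vec w1) = (- dot w1 w1) *: (vec v1 * vec v2) :> Cl.
  transitivity (vec v1 * (vec v1 * vec w2) * vec w1 : Cl).
    by rewrite mulrA vec_sq v11 -!scalerAl mul1r.
  by rewrite e -!mulrA vec_sq -!scalerAr mulr1.
have h2 : (- l) *: (vec w1 * vec w2) = (- dot w1 w1) *: (vec v2 * vec v1) :> Cl.
  transitivity (vec w1 * (vec w2 * vec v1) * vec v1 : Cl).
    by rewrite -!mulrA vec_sq v11 -!scalerAr mulr1.
  by rewrite et !mulrA vec_sq -!scalerAl mul1r.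
have : (- l) *: (vec w1 * vec w2 + vec w2 * vec w1) = 0 :> Cl.
  rewrite scalerDr h1 h2 -scalerDr vec_anticomm dotC v12 mul0rn oppr0 scale0r.
  by rewrite scaler0.
move/eqP; rewrite scaler_eq0 oppr_eq0 (negbTE l_neq0) /= vec_anticomm scaler_eq0.
by rewrite oner_eq0 orbF oppr_eq0 -[_ *+ 2]mulr_natr mulf_eq0 pnatr_eq0 orbF => /eqP.
Qed.

Lemma pairing20E (alpha beta : R * R -> 'rV[R]_n) : pairing20 alpha beta =
  4^-1 * ((dot (alpha (1, 0)) (beta (1, 0)) - dot (alpha (0, 1)) (beta (0, 1)))%:C%C
   - 'i * (dot (alpha (1, 0)) (beta (0, 1)) + dot (alpha (0, 1)) (beta (1, 0)))%:C%C).
Proof.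
rewrite /pairing20 /dot -sumrN -!big_split /= !raddf_sum /= !mulr_sumr -sumrB.
rewrite mulr_sumr; apply: eq_bigr => i _; rewrite !mxE.
rewrite !rmorphB !rmorphD !rmorphM /=.
have ii : 'i * 'i = -1 :> R[i] by rewrite -expr2 sqrCi.
have -> : (4^-1 : R[i]) = 2^-1 * 2^-1 by rewrite -invfM -natrM.
(* With the imaginary unit replaced by a letter the identity becomes polynomial, and only the rule j
   * j = -1 is substituted by hand. *)
move: 'i ii => j ii.
transitivity (2^-1 * 2^-1 * ((alpha (1, 0) 0 i)%:C%C * (beta (1, 0) 0 i)%:C%C
  + j * j * ((alpha (0, 1) 0 i)%:C%C * (beta (0, 1) 0 i)%:C%C)
  - j * ((alpha (1, 0) 0 i)%:C%C * (beta (0, 1) 0 i)%:C%C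
        + (alpha (0, 1) 0 i)%:C%C * (beta (1, 0) 0 i)%:C%C))); first by ring.
by rewrite ii; ring.
Qed.

Lemma pairing20_eq (a b a' b' : R * R -> 'rV[R]_n) :
  (forall X Y, dot (a X) (b Y) = dot (a' X) (b' Y)) -> pairing20 a b = pairing20 a' b'.
Proof. by move=> ab; rewrite !pairing20E !ab. Qed.

Lemma dot0r (v : 'rV[R]_n) : dot v 0 = 0.
Proof. by rewrite /dot big1// => k _; rewrite mxE mulr0. Qed.

Lemma pairing20_eq0 (alpha beta : R * R -> 'rV[R]_n) :
  beta (1, 0) = 0 -> beta (0, 1) = 0 -> pairing20 alpha beta = 0.
Proof. by move=> b1 b2; rewrite pairing20E b1 b2 !dot0r subrr addr0 mulr0 subrr mulr0. Qed.

Lemma pairing20C (alpha beta : R * R -> 'rV[R]_n) :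
  pairing20 alpha beta = pairing20 beta alpha.
Proof. by rewrite !pairing20E ![dot (beta _) _]dotC [X in _ - 'i * X%:C%C]addrC. Qed.

End ChristoffelAlgebra.

(** * Clifford-valued smooth maps *)

Section CliffordCalculus.
Variables (R : realType) (n : nat).
Local Notation Cl := (clifford R n).
Local Notation ex := ((1, 0) : R * R).
Local Notation ey := ((0, 1) : R * R).
Implicit Types (D : set (R * R)) (a b e : R * R -> Cl) (z v : R * R).

Lemma differentiable_coef a z S : differentiable a z ->
  differentiable (fun y => coef (a y) S) z /\
  forall v, 'D_v (fun y => coef (a y) S) z = coef ('D_v a z) S.
Proof.
by move=> da; split=> [|v];
  [exact: (derive_coord ex (enum_rank S) da).1|exact: (derive_coord v (enum_rank S) da).2].
Qed.

Lemma differentiable_of_coef a z : (forall S, differentiable (fun y => coef (a y) S) z) ->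
  differentiable a z.
Proof.
move=> da; apply: (@differentiable_row R) => j.
by have := da (enum_val j); rewrite /coef enum_valK.
Qed.

Lemma Ck_coef k D a S : open D -> Ck k D a -> Ck k D (fun y => coef (a y) S).
Proof. exact: Ck_coord. Qed.

Lemma Ck_of_coef k D a : open D -> (forall S, Ck k D (fun y => coef (a y) S)) -> Ck k D a.
Proof.
move=> oD ca; apply: (@Ck_row R) => // j.
by have := ca (enum_val j); rewrite /coef enum_valK.
Qed.

Lemma smooth_mul D a b : open D -> smooth D a -> smooth D b ->
  smooth D (fun z => a z * b z).
Proof.
move=> oD sa sb k; apply: Ck_of_coef => // W.
under eq_fun do rewrite Defs.coefM.
apply: Ck_sum => // S; apply: Ck_mul => //; first exact: Ck_cst.
by apply: Ck_mul => //; apply: Ck_coef.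
Qed.

Lemma differentiable_mul a b z : differentiable a z -> differentiable b z ->
  differentiable (fun y => a y * b y) z /\
  forall v, 'D_v (fun y => a y * b y) z = 'D_v a z * b z + a z * 'D_v b z.
Proof.
move=> da db.
have dc S : differentiable (fun y => coef (a y * b y) S) z /\ forall v,
    'D_v (fun y => coef (a y * b y) S) z = coef ('D_v a z * b z + a z * 'D_v b z) S.
  pose F T y := (-1) ^+ ninv T (symdiff T S) * (coef (a y) T * coef (b y) (symdiff T S)) : R.
  have dF T : differentiable (F T) z.
    apply: differentiableM; first exact: differentiable_cst.
    apply: differentiableM; first exact: (differentiable_coef _ da).1.
    exact: (differentiable_coef _ db).1.
  have FE : (fun y => coef (a y * b y) S) = \sum_(j < #|{set 'I_n}|) F (enum_val j).
    apply/funext => y; rewrite fct_sumE Defs.coefM.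
    rewrite (reindex (fun j : 'I_#|{set 'I_n}| => enum_val j : {set 'I_n}))//=.
    by exists enum_rank => T _; rewrite ?enum_valK ?enum_rankK.
  split=> [|v]; rewrite FE; first exact: differentiable_sum.
  rewrite derive_sum; last by move=> j; exact: diff_derivable.
  rewrite Defs.coefD !Defs.coefM -big_split /=.
  rewrite [RHS](reindex (fun j : 'I_#|{set 'I_n}| => enum_val j : {set 'I_n}))/=; last first.
    by exists enum_rank => T _; rewrite ?enum_valK ?enum_rankK.
  apply: eq_bigr => j _; rewrite /F; set T := enum_val j.
  have [da1 da2] := differentiable_coef T da.
  have [db1 db2] := differentiable_coef (symdiff T S) db.
  have dg : derivable (fun y => coef (a y) T * coef (b y) (symdiff T S)) z v.
    by apply/diff_derivable/differentiableM.
  rewrite [LHS](deriveZ _ dg) deriveM; [|exact: diff_derivable..].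
  rewrite da2 db2; set a1 := coef ('D_v a z) T; set b1 := coef ('D_v b z) _.
  move: a1 b1 (coef (a z) T) (coef (b z) _) (_ ^+ _) => a1 b1 a0 b0 c.
  by rewrite /GRing.scale /=; ring.
have dab : differentiable (fun y => a y * b y) z.
  by apply: differentiable_of_coef => S; exact: (dc S).1.
split=> // v; apply: coefP => S.
by rewrite -(differentiable_coef S dab).2 (dc S).2.
Qed.

Lemma derive_linear (m : nat) (V : normedModType R) (L : {linear 'rV[R]_m -> V})
    (h : R * R -> 'rV[R]_m) z : differentiable h z ->
  differentiable (fun y => L (h y)) z /\
  forall v, 'D_v (fun y => L (h y)) z = L ('D_v h z).
Proof. by apply: derive_comp_linear; exact: linear_row_continuous. Qed.

Lemma smooth_vec D (h : R * R -> 'rV[R]_n) : open D -> smooth D h ->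
  smooth D (fun z => vec (h z) : Cl).
Proof. by move=> oD sh l; exact: (@Ck_linear R n Cl l D (@vec R n) h oD (sh l)). Qed.

Lemma smooth_transp D a : open D -> smooth D a -> smooth D (fun z => transp (a z) : Cl).
Proof. by move=> oD sa l; exact: (@Ck_linear R _ Cl l D (@transp R n) a oD (sa l)). Qed.

Lemma smooth_unvec D a : open D -> smooth D a -> smooth D (fun z => unvec (a z)).
Proof. by move=> oD sa l; exact: (@Ck_linear R _ _ l D (@unvec R n) a oD (sa l)). Qed.

Lemma smooth_scale (m : nat) D (k : R) (h : R * R -> 'rV[R]_m) : open D -> smooth D h ->
  smooth D (fun z => k *: h z).
Proof.
move=> oD sh l; apply: Ck_row => // j; under eq_fun do rewrite mxE.
by apply: Ck_mul => //; [exact: Ck_cst|exact: Ck_coord].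
Qed.

Lemma derive_vec (h : R * R -> 'rV[R]_n) z : differentiable h z ->
  differentiable (fun y => vec (h y) : Cl) z /\
  forall v, 'D_v (fun y => vec (h y) : Cl) z = vec ('D_v h z).
Proof. exact: (@derive_linear n Cl (@vec R n)). Qed.

Lemma derive_transp a z : differentiable a z ->
  differentiable (fun y => transp (a y) : Cl) z /\
  forall v, 'D_v (fun y => transp (a y) : Cl) z = transp ('D_v a z).
Proof. exact: (@derive_linear _ Cl (@transp R n)). Qed.

Lemma derive_unvec a z : differentiable a z ->
  differentiable (fun y => unvec (a y)) z /\
  forall v, 'D_v (fun y => unvec (a y)) z = unvec ('D_v a z).
Proof. exact: (@derive_linear _ _ (@unvec R n)). Qed.

Lemma derive_swap_row (m : nat) D (h : R * R -> 'rV[R]_m) z : open D -> smooth D h -> D z ->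
  'D_ey ('D_ex h) z = 'D_ex ('D_ey h) z.
Proof.
move=> oD sh Dz; apply/rowP => j.
have sd (g : R * R -> 'rV[R]_m) y v : smooth D g -> D y ->
    'D_v (fun x => g x 0 j) y = 'D_v g y 0 j.
  by move=> sg Dy; exact: (derive_coord v j (smooth_differentiable sg Dy)).2.
have shj : smooth D (fun y => h y 0 j) by move=> k; exact: Ck_coord.
have dd v w : 'D_w (fun y => 'D_v h y 0 j) z = 'D_w ('D_v (fun y => h y 0 j)) z.
  apply: near_eq_derive; apply: (open_near_eq oD Dz) => y Dy.
  by rewrite (sd h y v sh Dy).
have e1 := sd ('D_ex h) z ey (smooth_derive ex sh) Dz.
have e2 := sd ('D_ey h) z ex (smooth_derive ey sh) Dz.
exact: etrans (esym e1) (etrans (etrans (dd ex ey)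
  (etrans (derive_swap oD shj Dz) (esym (dd ey ex)))) e2).
Qed.

(** The two sides are the cross derivatives of c w c^t when dc = c' v. The terms with c' on the left
    agree by the wedge relation, those with c'^t on the right by its transpose, and [d = d'] is
    symmetry of second derivatives. *)
Lemma sandwich_wedge (c c' d d' : Cl) (v1 v2 w1 w2 : 'rV[R]_n) : d = d' ->
  vec v1 * vec w2 - vec v2 * vec w1 = 0 :> Cl ->
  (c' * vec v2 * vec w1 + c * d) * transp c + c * vec w1 * transp (c' * vec v2) =
  (c' * vec v1 * vec w2 + c * d') * transp c + c * vec w2 * transp (c' * vec v1).
Proof.
move=> <- /eqP; rewrite subr_eq0 => /eqP e1.
have e2 := congr1 (@transp R n) e1; rewrite !transpM !transp_vec in e2.
rewrite !transpM !transp_vec -(mulrA c' (vec v2)) -e1 -(mulrA c' (vec v1)).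
by rewrite (mulrA (c * vec w1)) -(mulrA c (vec w1)) -e2 !mulrA.
Qed.

Lemma closed_sandwich D (k : R) e e' (phi w : R * R -> 'rV[R]_n) :
  open D -> smooth D e -> smooth D w ->
  (forall z v, D z -> 'D_v e z = e' z * vec ('D_v phi z)) ->
  (forall z, D z ->
     vec ('D_ex phi z) * vec ('D_ey w z) - vec ('D_ey phi z) * vec ('D_ex w z) = 0 :> Cl) ->
  let A v z := k *: unvec (e z * vec ('D_v w z) * transp (e z)) in
  (forall v, smooth D (A v)) /\
  forall z, D z -> 'D_ey (A ex) z = 'D_ex (A ey) z.
Proof.
move=> oD se sw de wedge0 A.
split=> [v|z Dz].
  apply: smooth_scale => //; apply: smooth_unvec => //.
  apply: smooth_mul => //; last exact: smooth_transp.
  by apply: smooth_mul => //; apply: smooth_vec => //; exact: smooth_derive.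
have dE := smooth_differentiable se Dz.
have dS v x : 'D_x (A v) z = k *: unvec
    ((e' z * vec ('D_x phi z) * vec ('D_v w z) + e z * vec ('D_x ('D_v w) z)) * transp (e z)
     + e z * vec ('D_v w z) * transp (e' z * vec ('D_x phi z))).
  have dw := smooth_differentiable (smooth_derive v sw) Dz.
  have ez := de z x Dz.
  have [d1 D1] := derive_vec dw.
  have [d2 D2] := derive_transp dE.
  have [d3 D3] := differentiable_mul dE d1.
  have [d4 D4] := differentiable_mul d3 d2.
  have [d5 D5] := derive_unvec d4.
  have d6 := diff_derivable (v := x) d5.
  have E2 := etrans (D2 x) (congr1 (@transp R n) ez).
  have E3 := etrans (D3 x)
    (congr2 (fun c d : Cl => c * vec ('D_v w z) + e z * d) ez (D1 x)).
  have E4 := etrans (D4 x)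
    (congr2 (fun c d : Cl => c * transp (e z) + e z * vec ('D_v w z) * d) E3 E2).
  have E5 := etrans (D5 x) (congr1 (@unvec R n) E4).
  by rewrite [LHS](deriveZ k d6) E5.
have key x y : 'D_y ('D_x w) z = 'D_x ('D_y w) z ->
    vec ('D_x phi z) * vec ('D_y w z) - vec ('D_y phi z) * vec ('D_x w z) = 0 :> Cl ->
    'D_y (A x) z = 'D_x (A y) z.
  move=> sxy wxy; apply: etrans (dS x y) (etrans _ (esym (dS y x))).
  apply: (congr1 (fun c => k *: unvec c)).
  by apply: sandwich_wedge wxy; exact: (congr1 (@vec R n) sxy).
exact: key (derive_swap_row oD sw Dz) (wedge0 z Dz).
Qed.

End CliffordCalculus.

(** * Differentials on a Riemann surface *)

Section SurfaceCalculus.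
Variables (R : realType) (M : riemann_surface R).
Local Notation ex := ((1, 0) : R * R).
Local Notation ey := ((0, 1) : R * R).
Local Notation img i V := (chart M i @` (dom M i `&` V)).
Implicit Types (U V : set M) (W : normedModType R) (i j : chart_index M) (p q : M).

Lemma img_chart i V p : dom M i p -> V p -> img i V (chart M i p).
Proof. by move=> ip Vp; exists p. Qed.

(** The bridge between the two topologies: a neighbourhood in the coordinate plane consists of chart
    values of points of [V], so local identities on the surface can be differentiated in
    coordinates. *)
Lemma near_param i V p : open V -> dom M i p -> V p ->
  \forall z \near chart M i p, exists q, [/\ dom M i q, V q & z = chart M i q].
Proof.
move=> oV ip Vp.
have iz : (chart M i @` dom M i) (chart M i p) by exists p.
have near1 := open_nbhs_nbhs (conj (chart_open (i := i)) iz).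
have near2 : nbhs (chart M i p) (param M i @^-1` V).
  apply: (param_continuous iz); rewrite chartK//.
  exact: open_nbhs_nbhs (conj oV Vp).
apply: filterS2 near1 near2 => _ [q iq <-] /=; rewrite chartK// => Vq.
by exists q.
Qed.

Lemma open_img i V : open V -> open (img i V).
Proof.
move=> oV; rewrite openE => _ [p [ip Vp] <-]; rewrite /interior.
by apply: filterS (near_param oV ip Vp) => z [q [iq Vq ->]]; exists q.
Qed.

Lemma smooth_on_sub W U V (h : M -> W) : V `<=` U -> smooth_on U h -> smooth_on V h.
Proof.
move=> VU sh i k; apply: Ck_sub (sh i k) => _ [p [ip Vp] <-].
by exists p; split=> //; exact: VU.
Qed.

Lemma smooth_on_differentiable W V (h : M -> W) i p : smooth_on V h ->
  dom M i p -> V p -> differentiable (h \o param M i) (chart M i p).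
Proof. by move=> sh ip Vp; exact: smooth_differentiable (sh i) (img_chart ip Vp). Qed.

Lemma near_eq_chart W V (h h' : M -> W) i p : open V -> dom M i p -> V p ->
  (forall q, V q -> h q = h' q) ->
  \forall z \near chart M i p, (h \o param M i) z = (h' \o param M i) z.
Proof.
move=> oV ip Vp hh'; apply: filterS (near_param oV ip Vp) => z [q [iq Vq ->]].
by rewrite /= chartK// hh'.
Qed.

Lemma dif_eq W V (h h' : M -> W) i p X : open V -> dom M i p -> V p ->
  (forall q, V q -> h q = h' q) -> dif i h p X = dif i h' p X.
Proof. by move=> oV ip Vp hh'; apply: near_eq_derive; exact: near_eq_chart hh'. Qed.

Lemma dif_plane W (h : M -> W) i p X : differentiable (h \o param M i) (chart M i p) ->
  dif i h p X = X.1 *: dif i h p ex + X.2 *: dif i h p ey.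
Proof.
move=> dh; rewrite /dif !deriveE// -!linearZ -linearD; congr ('d _ _ _).
by case: X => x y; congr pair; rewrite /= /GRing.scale /=; ring.
Qed.

Definition transition_dif i j p X : R * R := 'D_X (chart M i \o param M j) (chart M j p).

Lemma dif_transition W (h : M -> W) i j p : dom M i p -> dom M j p ->
  differentiable (h \o param M i) (chart M i p) ->
  differentiable (h \o param M j) (chart M j p) /\
  forall X, dif j h p X = dif i h p (transition_dif i j p X).
Proof.
move=> ip jp dh; pose T := chart M i \o param M j.
have Tp : T (chart M j p) = chart M i p by rewrite /T /= chartK.
have dT : differentiable T (chart M j p).
  by apply: smooth_differentiable (transition_holomorphic j i).1 _; exists p.
have E : \forall z \near chart M j p, ((h \o param M i) \o T) z = (h \o param M j) z.
  apply: filterS (near_param (dom_open i) jp ip) => z [q [jq iq ->]].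
  by rewrite /T /= !chartK.
have dh' : differentiable (h \o param M i) (T (chart M j p)) by rewrite Tp.
have dhT := differentiable_comp dT dh'.
split=> [|X]; first exact: near_eq_differentiable dhT.
have e1 := near_eq_derive X E.
have e2 := etrans (deriveE X dhT) (congr1 (fun g => g X) (diff_comp dT dh')).
have e3 := congr2 (fun z y => 'd (h \o param M i) z y) Tp (esym (deriveE X dT)).
exact: etrans (esym e1) (etrans e2 (etrans e3 (esym (deriveE _ dh)))).
Qed.

(** By the transformation rule a zero coefficient in one chart is zero in every chart around the
    point. *)
Lemma nonvanishing_qcoef (Q : quadratic_differential M) i p :
  nonvanishing_at Q p -> dom M i p -> qcoef Q i (chart M i p) != 0.
Proof.
move=> [j [jp Qj]] ip; apply: contraNN Qj => /eqP Qi.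
have := qcoef_transition Q jp ip; rewrite Qi mul0r => ->; exact: eqxx.
Qed.

Lemma open_nonvanishing (Q : quadratic_differential M) : open [set p | nonvanishing_at Q p].
Proof.
rewrite openE => p [i [ip Qp]]; rewrite /interior.
have cQ : {for chart M i p, continuous (@of_complex R \o qcoef Q i)}.
  by apply: ((qcoef_holomorphic Q i).1 0%N); exists p.
have Q0 z : ((@of_complex R \o qcoef Q i) z != 0) = (qcoef Q i z != 0).
  rewrite /= /of_complex; case: (qcoef Q i z) => x y /=.
  by rewrite eq_complex /= -[(x, y) == 0]/((x == 0) && (y == 0)).
have nQ : \forall z \near chart M i p, qcoef Q i z != 0.
  have : (@of_complex R \o qcoef Q i) (chart M i p) != 0 by rewrite Q0.
  move=> Qn; have nz : \forall z \near chart M i p, (@of_complex R \o qcoef Q i) z != 0.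
      exact: cvgr_neq0 cQ Qn.
    by apply: filterS nz => z; rewrite Q0.
have nC : \forall q \near p, qcoef Q i (chart M i q) != 0 by exact: (chart_continuous ip nQ).
have nD : \forall q \near p, dom M i q by exact: (open_nbhs_nbhs (conj (dom_open i) ip)).
by apply: filterS2 nC nD => q Qq iq; exists i.
Qed.

End SurfaceCalculus.

(** * Integrating sandwich forms to local Christoffel transforms *)

Section Frames.
Variables (R : realType) (n : nat) (M : riemann_surface R).
Local Notation Cl := (clifford R n).
Local Notation ex := ((1, 0) : R * R).
Local Notation ey := ((0, 1) : R * R).
Local Notation img i V := (chart M i @` (dom M i `&` V)).
Implicit Types (U V : set M) (Q : quadratic_differential M).
Implicit Types (e : M -> Cl) (phi w h : M -> 'rV[R]_n).

Lemma dif_mul U (a b : M -> Cl) i p X : smooth_on U a -> smooth_on U b ->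
  dom M i p -> U p ->
  dif i (fun q => a q * b q) p X = dif i a p X * b p + a p * dif i b p X.
Proof.
move=> sa sb ip Up.
have da := smooth_on_differentiable sa ip Up.
have db := smooth_on_differentiable sb ip Up.
by have := (differentiable_mul da db).2 X; rewrite /= chartK.
Qed.

Lemma cdifE U h i p X : smooth_on U h -> dom M i p -> U p ->
  dif i (fun q => vec (h q) : Cl) p X = vec (dif i h p X).
Proof.
move=> sh ip Up.
exact: (derive_vec (smooth_on_differentiable sh ip Up)).2.
Qed.

Lemma unvec_sandwich_linear (c : Cl) (k x y : R) (v1 v2 : 'rV[R]_n) :
  x *: (k *: unvec (c * vec v1 * transp c)) + y *: (k *: unvec (c * vec v2 * transp c)) =
  k *: unvec (c * vec (x *: v1 + y *: v2) * transp c).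
Proof.
have lin2 (X Y : lmodType R) (L : {linear X -> Y}) u v :
    L (x *: u + y *: v) = x *: L u + y *: L v by rewrite linearD !linearZ.
have -> : vec (x *: v1 + y *: v2) = x *: vec v1 + y *: vec v2 :> Cl.
  exact: (lin2 _ _ (@vec R n)).
rewrite mulrDr mulrDl -!scalerAr -!scalerAl (lin2 _ _ (@unvec R n)) scalerDr.
by congr (_ + _); rewrite !scalerA mulrC.
Qed.

(** [closed_sandwich] gives closedness, and the primitive is built in a single chart around [p]. In
    any other chart the formula persists because both sides change by the same transition
    derivative. *)
Lemma local_primitive U p (k : R) e (e' : M -> Cl) phi w : open U -> U p ->
  smooth_on U e -> smooth_on U w ->
  (forall i q X, dom M i q -> U q -> dif i e q X = e' q * vec (dif i phi q X)) ->
  (forall i q, dom M i q -> U q ->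
     wedge (cdif i phi q) (cdif i w q) ex ey = 0) ->
  exists V h, [/\ open V, V p, V `<=` U, smooth_on V h &
    forall i q X, dom M i q -> V q ->
      dif i h q X = k *: unvec (e q * vec (dif i w q X) * transp (e q))].
Proof.
move=> oU Up se sw de wedge0.
pose A i v z := k *: unvec (e (param M i z) *
  vec ('D_v (w \o param M i) z) * transp (e (param M i z))).
have AE i q v : dom M i q -> A i v (chart M i q) =
    k *: unvec (e q * vec (dif i w q v) * transp (e q)).
  by move=> iq; rewrite /A chartK.
have closed i : (forall v, smooth (img i U) (A i v)) /\
    forall z, img i U z -> 'D_ey (A i ex) z = 'D_ex (A i ey) z.
  apply: (@closed_sandwich R n (img i U) k (e \o param M i) (e' \o param M i)
    (phi \o param M i) (w \o param M i)).
  - exact: open_img.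
  - exact: se.
  - exact: sw.
  - move=> _ v [q [iq Uq] <-]; rewrite /= chartK//; exact: de.
  - move=> _ [q [iq Uq] <-]; exact: wedge0.
have [i ip] := dom_cover p.
have [E [H [oE Ep EU dH]]] := poincare_row (open_img oU) (img_chart ip Up)
  ((closed i).1 ex) ((closed i).1 ey) (closed i).2.
pose V : set M := [set q | dom M i q /\ E (chart M i q)].
have VU : V `<=` U.
  move=> q [iq /EU[q' [iq' Uq'] qq']].
  by rewrite -(chartK iq) -qq' chartK.
have oV : open V.
  rewrite openE => q [iq Eq]; rewrite /interior.
  have n1 : \forall q' \near q, E (chart M i q').
    exact: (chart_continuous iq (open_nbhs_nbhs (conj oE Eq))).
  have n2 : \forall q' \near q, dom M i q'.
    exact: (open_nbhs_nbhs (conj (dom_open i) iq)).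
  by apply: filterS2 n1 n2 => q'; split.
have dh j q : dom M j q -> V q ->
    differentiable ((H \o chart M i) \o param M j) (chart M j q) /\
    forall X, dif j (H \o chart M i) q X =
      k *: unvec (e q * vec (dif j w q X) * transp (e q)).
  move=> jq Vq; have [iq Eq] := Vq; have Uq := VU q Vq.
  have HE : \forall z \near chart M i q, H z = ((H \o chart M i) \o param M i) z.
    apply: filterS (near_param oV iq Vq) => z [q' [iq' Vq' ->]].
    by rewrite /= chartK.
  have [dHq HD] := dH _ Eq.
  have dHi := near_eq_differentiable HE dHq.
  have dw := smooth_on_differentiable sw iq Uq.
  have difi X : dif i (H \o chart M i) q X =
      k *: unvec (e q * vec (dif i w q X) * transp (e q)).
    have -> : dif i (H \o chart M i) q X = 'D_X H (chart M i q).
      exact/esym/near_eq_derive.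
    have e1 := congr2 (fun a b => X.1 *: a + X.2 *: b) (AE i q ex iq) (AE i q ey iq).
    have e2 := congr1 (fun v => k *: unvec (e q * vec v * transp (e q))) (dif_plane X dw).
    exact: etrans (HD X) (etrans e1 (etrans (unvec_sandwich_linear _ _ _ _ _ _) (esym e2))).
  have [dj difj] := dif_transition iq jq dHi.
  have [_ wj] := dif_transition iq jq dw.
  split=> [|X]; first exact: dj.
  have e1 := difj X.
  have e2 := difi (transition_dif i j q X).
  have e3 := congr1 (fun v => k *: unvec (e q * vec v * transp (e q))) (wj X).
  exact: etrans e1 (etrans e2 (esym e3)).
exists V, (H \o chart M i); split => // [|j q X jq Vq]; last exact: (dh j q jq Vq).2.
(* Smoothness is inherited from the form: the primitive is differentiable and its directional
   derivatives are the smooth maps [A j v]. *)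
move=> j; apply: smoothP => [_ [q [jq Vq] <-]|v]; first exact: (dh j q jq Vq).1.
move=> l; apply: (@Ck_eq _ _ _ _ (A j v)); first exact: open_img.
  move=> _ [q [jq Vq] <-].
  exact: etrans (AE j q v jq) (esym ((dh j q jq Vq).2 v)).
apply: Ck_sub ((closed j).1 v l) => _ [q [jq Vq] <-].
by exists q; split=> //; exact: VU.
Qed.

(* [v |-> u^-t v u^-1] and [v |-> u v u^t] are multiples of isometries of R^n
   that are adjoint inverses of each other: applying the first to dphi and the
   second to dw keeps the wedge product and the pairing. *)
Lemma isothermic_frame U Q p (k : R) e (e' : M -> Cl) phi w h : open U -> U p -> k != 0 ->
  (forall q, U q -> Gamma (e q)) -> smooth_on U e -> smooth_on U h ->
  isothermic_with U Q phi w ->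
  (forall i q X, dom M i q -> U q -> dif i e q X = e' q * vec (dif i phi q X)) ->
  (forall i q X, dom M i q -> U q -> vec (dif i h q X) =
     k *: ((transp (e q))^-1 * vec (dif i phi q X) * (e q)^-1)) ->
  exists V hc, [/\ open V, V p, V `<=` U, isothermic_with V Q h hc &
    forall i q X, dom M i q -> V q ->
      vec (dif i hc q X) = k^-1 *: (e q * vec (dif i w q X) * transp (e q))].
Proof.
move=> oU Up k0 Ge se sh [[sphi cphi] [sw cw]] de dh.
have [|V [hc [oV Vp VU shc dhc]]] := local_primitive k^-1 oU Up se sw de.
  by move=> i q iq Uq; exact: (cw i q iq Uq).1.
have vhc i q X : dom M i q -> V q ->
    vec (dif i hc q X) = k^-1 *: (e q * vec (dif i w q X) * transp (e q)).
  move=> iq Vq; rewrite (dhc i q X iq Vq) linearZ /=; congr (_ *: _).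
  have [[v ->] _] := Gamma_sandwich (Ge q (VU q Vq)) (dif i w q X).
  by rewrite vecK.
(* Rewriting e^-t and e^-1 through e and e^t puts dh into the sandwich shape of dhc, so the
   [normed_sandwich] lemmas apply to both. *)
have vh i q X m : dom M i q -> V q -> normed (e q) m ->
    vec (dif i h q X) = (k * m^-1 * m^-1) *: (e q * vec (dif i phi q X) * transp (e q)).
  move=> iq Vq em; rewrite (dh i q X iq (VU q Vq)).
  have [_ -> ->] := normed_inv em.
  by rewrite -!scalerAl -!scalerAr !scalerA.
exists V, hc; split => //; split.
  split=> [|i q iq Vq]; first exact: smooth_on_sub sh.
  have [l l0 lE] := cphi i q iq (VU q Vq).
  have [m em] := Gamma_normed (Ge q (VU q Vq)); have [m0 _ _] := em.
  (* The scalar k m^-2 enters twice and the sandwich contributes m^2. In the pairing below the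
     scalars are k m^-2 and k^-1, whose product with m^2 is 1. *)
  exists (k ^+ 2 / m ^+ 2 * l) => [|X Y].
    by rewrite mulr_gt0// divr_gt0// lt0r sqr_ge0 andbT expf_neq0.
  rewrite (normed_sandwich_dot em (vh i q X m iq Vq em) (vh i q Y m iq Vq em)) lE.
  by field.
split=> // i q iq Vq; have [wq qq] := cw i q iq (VU q Vq).
have [m em] := Gamma_normed (Ge q (VU q Vq)); have [m0 eet ete] := em.
split=> [X Y|].
  exact: normed_sandwich_wedge em (vh i q X m iq Vq em) (vh i q Y m iq Vq em)
    (vhc i q X iq Vq) (vhc i q Y iq Vq) (wq X Y).
have dotE X Y : dot (dif i h q X) (dif i hc q Y) = dot (dif i phi q X) (dif i w q Y).
  rewrite (normed_sandwich_dot em (vh i q X m iq Vq em) (vhc i q Y iq Vq)).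
  by field; rewrite k0 m0.
exact: etrans (pairing20_eq dotE) qq.
Qed.

End Frames.

(** * The moving frame of an isothermic surface *)

Section VahlenFrame.
Variables (R : realType) (n : nat).
Local Notation Cl := (clifford R n).
Implicit Types (a b c d g h u v w x y : Cl) (k l m : R).

Lemma normed_unit u m : normed u m -> u \is a GRing.unit /\ transp u \is a GRing.unit.
Proof.
move=> um; have [uU _ _] := normed_inv um; split=> //.
have [m0 uu tuu] := um; apply/unitrP; exists (m^-1 *: u).
by rewrite -scalerAl uu -scalerAr tuu scalerA mulVf// scale1r.
Qed.

(** The Vahlen condition gives c^t d = d^t c; multiplying on the two sides by c and c^t, or by d and
    d^t, and dividing by the norm moves the transposes to the other side. *)
Lemma vahlen_transpC c d m : is_vec (transp c * d) -> normed c m \/ normed d m ->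
  c * transp d = d * transp c.
Proof.
move=> /is_vec_transp; rewrite transpM transpK => cd.
have conj u l a : normed u l -> u * (transp u * a) = l *: a.
  by move=> [_ uu _]; rewrite mulrA uu -scalerAl mul1r.
have conj' u l a : normed u l -> a * u * transp u = l *: a.
  by move=> [_ uu _]; rewrite -mulrA uu -scalerAr mulr1.
case=> [cm|dm].
  have [m0 _ _] := cm; apply: (scalerI m0).
  by rewrite -(conj' _ _ (c * transp d) cm) -(mulrA c) cd (conj _ _ _ cm) scalerAl.
have [m0 _ _] := dm; apply: (scalerI m0).
by rewrite -(conj' _ _ (d * transp c) dm) -(mulrA d) -cd (conj _ _ _ dm) scalerAl.
Qed.

Lemma vahlen_zero a b c d x : c * transp d = d * transp c ->
  a * transp d - b * transp c = 1 -> x * d = b -> (a - x * c) * transp d = 1.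
Proof. by move=> cd <- <-; rewrite mulrBl -!mulrA cd. Qed.

Lemma vahlen_infty a b c d y : c * transp d = d * transp c ->
  a * transp d - b * transp c = 1 -> y * c = a -> (b - y * d) * transp c = -1.
Proof. by move=> cd <- <-; rewrite mulrBl -!mulrA cd opprB. Qed.

(** Serves both endpoints. The first equation is Leibniz for h u = numerator with w = dh, and (a - h
    b) u^t = s is the determinant condition, with s = 1 for f_r and s = -1 for fhat_r. *)
Lemma frame_derivative u m (k s : R) a b v w h : normed u m ->
  w * u + h * (k *: (b * v)) = k *: (a * v) -> (a - h * b) * transp u = s%:A ->
  w = (k * s) *: ((transp u)^-1 * v * u^-1).
Proof.
move=> um wE ab; have [uU tuU] := normed_unit um.
have abE : a - h * b = s *: (transp u)^-1.
  by rewrite -[LHS](mulrK tuU) ab -scalerAl mul1r.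
apply: (mulIr uU); rewrite -scalerAl (divrK uU) -scalerA scalerAl -abE mulrBl.
by rewrite scalerBr -wE -mulrA -scalerAr addrK.
Qed.

(** Two factorisations of [g] are recorded because in a product g x g the left and the right factor
    must cancel against different things. *)
Lemma darboux_difference c d m l g : normed c m -> normed d l ->
  c * transp d = d * transp c -> g * (c * transp d) = 1 ->
  [/\ g \is a GRing.unit, g^-1 = c * transp d,
      g = (transp d)^-1 * c^-1 & g = (transp c)^-1 * d^-1].
Proof.
move=> /normed_unit[cU ctU] /normed_unit[dU dtU] cd gcd.
have gE : g = (c * transp d)^-1.
  by rewrite -[LHS](mulrK (_ : c * transp d \is a GRing.unit)) ?gcd ?mul1r// unitrMl.
split; first by rewrite gE unitrV unitrMl.
- by rewrite gE invrK.
- by rewrite gE invrM.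
- by rewrite gE cd invrM.
Qed.

End VahlenFrame.

Section SmoothQuotient.
Variables (R : realType) (n : nat) (M : riemann_surface R).
Local Notation Cl := (clifford R n).

(** Division by [e] is multiplication by e^t over the scalar e e^t. That scalar is the coefficient
    of e e^t at the empty set, so only inversion of a real function is involved. *)
Lemma smooth_on_quotient (U : set M) (a e : M -> Cl) (h : M -> 'rV[R]_n) : open U ->
  smooth_on U a -> smooth_on U e -> (forall q, U q -> Gamma (e q)) ->
  (forall q, U q -> vec (h q) = a q / e q) -> smooth_on U h.
Proof.
move=> oU sa se Ge hE i; set D := chart M i @` _.
have oD : open D by exact: open_img.
pose N z := coef (e (param M i z) * transp (e (param M i z))) finset.set0 : R.
have st : smooth D (fun z => transp (e (param M i z)) : Cl).
  exact: smooth_transp (se i).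
have NE q m : normed (e q) m -> coef (e q * transp (e q)) finset.set0 = m.
  by move=> [_ -> _]; rewrite Defs.coefZ coef_basis eqxx mulr1.
have N0 z : D z -> N z != 0.
  move=> [q [iq Uq] <-]; rewrite /N chartK//.
  by have [m em] := Gamma_normed (Ge q Uq); rewrite (NE _ _ em); have [] := em.
have sN : smooth D N by move=> k; apply: Ck_coef => //; exact: smooth_mul (se i) st k.
pose B z : Cl := a (param M i z) * transp (e (param M i z)).
have sB : smooth D B by exact: smooth_mul (sa i) st.
move=> k; apply: (@Ck_eq _ _ _ _ (fun z => unvec ((N z)^-1 *: B z))) => //.
  move=> _ [q [iq Uq] <-]; rewrite /= /N /B chartK//.
  have [m em] := Gamma_normed (Ge q Uq); rewrite (NE _ _ em).
  by have [_ eV _] := normed_inv em; rewrite scalerAr -eV -hE// vecK.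
apply: smooth_unvec => // l; apply: Ck_of_coef => // S.
under eq_fun do rewrite Defs.coefZ.
by apply: Ck_mul => //; [exact: Ck_inv|exact: Ck_coef].
Qed.

Lemma nonconstant_dif (U : set M) (h : M -> 'rV[R]_n) i p X : open U -> U p ->
  dom M i p -> dif i h p X != 0 -> nonconstant_on U h.
Proof.
move=> oU Up ip dh; apply: contrapT => nc.
case/negP: dh; rewrite (@dif_eq _ _ _ U h (fun=> h p) i p X)// => [|q Uq].
  by rewrite /dif (_ : _ \o _ = cst (h p))// derive_cst.
by apply: contrapT => hqp; apply: nc; exists q, p; split=> //; exact/eqP.
Qed.

End SmoothQuotient.

Section FundamentalFrame.
Variables (R : realType) (n : nat) (M : riemann_surface R).
Local Notation Cl := (clifford R n).

Lemma log_derivative_entries (F : M -> 'M[Cl]_2) i p X (x y : Cl) :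
  log_derivative_is i F p X (mx2 0 x y 0) ->
  [/\ dif i (fun q => F q 0 0) p X = F p 0 1 * y,
      dif i (fun q => F q 0 1) p X = F p 0 0 * x,
      dif i (fun q => F q 1 0) p X = F p 1 1 * y &
      dif i (fun q => F q 1 1) p X = F p 1 0 * x].
Proof.
move=> [G [_ FG]]; set dF := \matrix_(k, l) _ => GdF.
have E : dF = F p *m mx2 0 x y 0 by rewrite -GdF mulmxA FG mul1mx.
have E' k l : dif i (fun q => F q k l) p X = F p k 0 * mx2 0 x y 0 0 l + F p k 1 * mx2 0 x y 0 1 l.
  have l1 : lift ord0 (ord0 : 'I_1) = 1 :> 'I_2 by exact: val_inj.
  by have := congr1 (fun A : 'M[Cl]_2 => A k l) E; rewrite !mxE big_ord_recl big_ord1 l1 !mxE.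
by rewrite !E' !mxE /= !mulr0 ?addr0 ?add0r.
Qed.

Lemma conformal_dif_neq0 (U : set M) (f : M -> 'rV[R]_n) i p :
  conformal_immersion U f -> dom M i p -> U p -> dif i f p (1, 0) != 0.
Proof.
move=> [_ cf] ip Up; have [l l0 lE] := cf i p ip Up.
rewrite -dot_eq0 lE /=; apply/eqP; move: l0; lra.
Qed.

Lemma conformal_of_frame (alpha : R * R -> 'rV[R]_n) (l : R) :
  (forall X, alpha X = X.1 *: alpha (1, 0) + X.2 *: alpha (0, 1)) ->
  dot (alpha (0, 1)) (alpha (0, 1)) = dot (alpha (1, 0)) (alpha (1, 0)) ->
  dot (alpha (1, 0)) (alpha (0, 1)) = 0 ->
  forall X Y, dot (alpha X) (alpha Y) =
    dot (alpha (1, 0)) (alpha (1, 0)) * (X.1 * Y.1 + X.2 * Y.2).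
Proof.
move=> lin e1 e2 X Y; rewrite (lin X) (lin Y) dot_lin2 e1 e2 dotC e2.
by ring.
Qed.

(** The wedge relation and the pairing are symmetric, so the point is that [fc] is a conformal
    immersion: [christoffel_conformal] gives the conformal frame, and a vanishing frame would make
    the pairing, hence [Q], zero. *)
Lemma christoffel_dual (U : set M) (Q : quadratic_differential M) (f fc : M -> 'rV[R]_n) :
  isothermic_with U Q f fc -> (forall p, U p -> nonvanishing_at Q p) ->
  isothermic_with U Q fc f.
Proof.
move=> [[sf cf] [sc cfc]] nv; split; last first.
  split=> [|i p ip Up]; first exact: sf.
  have [w0 q0] := cfc i p ip Up; split=> [X Y|]; last by rewrite pairing20C.
  exact: transp_wedge (w0 X Y).
split=> [|i p ip Up]; first exact: sc.
have [l l0 lE] := cf i p ip Up; have [w0 q0] := cfc i p ip Up.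
have E X : dif i fc p X = X.1 *: dif i fc p (1, 0) + X.2 *: dif i fc p (0, 1).
  exact: dif_plane (smooth_on_differentiable sc ip Up).
have [||||e1 e2] := @christoffel_conformal R n (dif i f p (1, 0)) (dif i f p (0, 1))
    (dif i fc p (1, 0)) (dif i fc p (0, 1)) l l0.
- by rewrite lE /=; ring.
- by rewrite lE /=; ring.
- by rewrite lE /=; ring.
- exact: w0.
exists (dot (dif i fc p (1, 0)) (dif i fc p (1, 0))).
  rewrite lt0r dot_ge0 andbT; apply/eqP => d0.
  have := nonvanishing_qcoef (nv p Up) ip; rewrite -q0.
  have /eqP := d0; rewrite dot_eq0 => /eqP z1.
  have /eqP := etrans e1 d0; rewrite dot_eq0 => /eqP z2.
  by rewrite pairing20_eq0 ?eqxx.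
exact: conformal_of_frame l E e1 e2.
Qed.

Lemma christoffel_dif_neq0 (U : set M) (Q : quadratic_differential M) (f fc : M -> 'rV[R]_n) i p :
  christoffel U Q f fc -> dom M i p -> U p -> nonvanishing_at Q p ->
  exists X, dif i fc p X != 0.
Proof.
move=> [_ cfc] ip Up nv; apply: contrapT => none.
have z X : dif i fc p X = 0 by apply: contrapT => zX; apply: none; exists X; exact/eqP.
have := nonvanishing_qcoef nv ip; rewrite -(cfc i p ip Up).2.
by rewrite pairing20_eq0 ?eqxx.
Qed.

End FundamentalFrame.

Theorem theorem2p11 (R : realType) (n : nat)
    (M : riemann_surface R) (Q : quadratic_differential M)
    (f fc : M -> 'rV[R]_n) (r : R) (F : M -> 'M[clifford R n]_2)
    (hQ : polarised setT Q)
    (hf : isothermic_with setT Q f fc)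
    (hF : forall p, SLGamma (F p))
    (hFs : forall k l, smooth_on setT (fun p => F p k l))
    (hdF : forall i p X, dom M i p ->
       log_derivative_is i F p X
         (mx2 0 (cdif i f p X) (r *: cdif i fc p X) 0))
    (U : set M) (hU : open U) (hQU : polarised U Q)
    (fr frhat : M -> 'rV[R]_n)
    (hfr : forall p, U p -> moebius (F p) (Some 0) (Some (fr p)))
    (hfrhat : forall p, U p -> moebius (F p) None (Some (frhat p))) :
  locally (fun V => isothermic V Q fr) U /\
  (r != 0 ->
    [/\ darboux_pair U fr frhat,
        locally (fun V => isothermic V Q frhat)
          (U `&` [set p | nonvanishing_at Q p]) &
        locally (fun V => darboux_transform V Q (- r) fr frhat) U]).
Proof.
pose a q : clifford R n := F q 0 0; pose b q : clifford R n := F q 0 1.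
pose c q : clifford R n := F q 1 0; pose d q : clifford R n := F q 1 1.
have sub := @subsetT _ U.
have [sa sb sc sd] : [/\ smooth_on U a, smooth_on U b, smooth_on U c & smooth_on U d].
  by split; exact: smooth_on_sub sub (hFs _ _).
have hfU : isothermic_with U Q f fc.
  have [[sf cf] [sfc cfc]] := hf; split; split.
  - exact: smooth_on_sub sub sf.
  - by move=> i p ip _; exact: cf.
  - exact: smooth_on_sub sub sfc.
  - by move=> i p ip _; exact: cfc.
have [[sf cf] [sfc cfc]] := hfU.
have dF i p X (ip : dom M i p) := log_derivative_entries (hdF i p X ip).
(* A finite value of the action has a nonzero denominator, which is [d] at the point 0 and [c] at
   infinity; a nonzero entry of a Vahlen matrix lies in [Gamma]. *)
have Gd q : U q -> Gamma (d q).
  move=> Uq; have [dq _] := hfr q Uq; have [[/(_ 1 1)[]// d0 _ _ _ _] _] := hF q.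
  by move: dq; rewrite d0 linear0 mulr0 add0r eqxx.
have Gc q : U q -> Gamma (c q).
  move=> Uq; have [cq _] := hfrhat q Uq; have [[/(_ 1 0)[]// c0 _ _ _ _] _] := hF q.
  by move: cq; rewrite c0 eqxx.
have frE q : U q -> vec (fr q) = b q / d q.
  by move=> Uq; have [_ ->] := hfr q Uq; rewrite linear0 !mulr0 !add0r.
have fhE q : U q -> vec (frhat q) = a q / c q by move=> Uq; have [_ ->] := hfrhat q Uq.
have sfr : smooth_on U fr by exact: smooth_on_quotient sb sd Gd frE.
have sfh : smooth_on U frhat by exact: smooth_on_quotient sa sc Gc fhE.
have det q : a q * transp (d q) - b q * transp (c q) = 1 by have [] := hF q.
have cd q : U q -> c q * transp (d q) = d q * transp (c q).
  move=> Uq; have [[_ _ _ _ v] _] := hF q; have [m dm] := Gamma_normed (Gd q Uq).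
  by apply: (vahlen_transpC v); right; exact: dm.
have frd q : U q -> vec (fr q) * d q = b q.
  move=> Uq; have [m /normed_unit[dU _]] := Gamma_normed (Gd q Uq).
  by rewrite frE// divrK.
have fhc q : U q -> vec (frhat q) * c q = a q.
  move=> Uq; have [m /normed_unit[cU _]] := Gamma_normed (Gc q Uq).
  by rewrite fhE// divrK.
have svec (h : M -> 'rV[R]_n) : smooth_on U h -> smooth_on U (fun q => vec (h q) : clifford R n).
  by move=> sh i; apply: smooth_vec (sh i); exact: open_img.
have dif_fr i q X : dom M i q -> U q -> vec (dif i fr q X) =
    1 *: ((transp (d q))^-1 * vec (dif i f q X) * (d q)^-1).
  move=> iq Uq; have [m dm] := Gamma_normed (Gd q Uq).
  have [_ dbE _ ddE] := dF i q X iq.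
  have e1 := dif_mul X (svec _ sfr) sd iq Uq.
  have e2 := dif_eq X hU iq Uq frd.
  have e3 := cdifE X sfr iq Uq.
  rewrite -[X in X *: _](mulr1 1).
  apply: (@frame_derivative R n _ _ 1 1 (a q) (c q) _ _ (vec (fr q)) dm).
    rewrite !scale1r -[RHS]dbE -[c q * _]ddE -e3 -[LHS]e1; exact: e2.
  rewrite scale1r; exact: vahlen_zero (cd q Uq) (det q) (frd q Uq).
have dif_fh i q X : dom M i q -> U q -> vec (dif i frhat q X) =
    (- r) *: ((transp (c q))^-1 * vec (dif i fc q X) * (c q)^-1).
  move=> iq Uq; have [m cm] := Gamma_normed (Gc q Uq).
  have [daE _ dcE _] := dF i q X iq.
  have e1 := dif_mul X (svec _ sfh) sc iq Uq.
  have e2 := dif_eq X hU iq Uq fhc.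
  have e3 := cdifE X sfh iq Uq.
  rewrite -mulrN1.
  apply: (@frame_derivative R n _ _ r (-1) (b q) (d q) _ _ (vec (frhat q)) cm).
    rewrite !scalerAr -[RHS]daE -[d q * _]dcE -e3 -[LHS]e1; exact: e2.
  rewrite scaleN1r; exact: vahlen_infty (cd q Uq) (det q) (fhc q Uq).
(* The differential of [hc] is kept explicitly: the Darboux equation at the end is verified with
   this Christoffel transform. *)
have locfr p : U p -> exists V hc, [/\ open V, V p, V `<=` U, isothermic_with V Q fr hc &
    forall i q X, dom M i q -> V q ->
      vec (dif i hc q X) = d q * vec (dif i fc q X) * transp (d q)].
  move=> Up.
  have [||V [hc [oV Vp VU ihc vhc]]] := @isothermic_frame R n M U Q p 1 d c f fc fr
    hU Up (oner_neq0 _) Gd sd sfr hfU.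
  - by move=> i q X iq _; have [_ _ _ ->] := dF i q X iq.
  - exact: dif_fr.
  exists V, hc; split => // i q X iq Vq.
  by rewrite (vhc i q X iq Vq) invr1 scale1r.
split.
  move=> p Up; have [V [hc [oV Vp VU ihc _]]] := locfr p Up.
  by exists V; split => //; exists hc.
move=> r0; have Nr0 : - r != 0 by rewrite oppr_eq0.
have gcd q : U q -> vec (frhat q - fr q) * (c q * transp (d q)) = 1.
  move=> Uq; rewrite linearB /= mulrA mulrBl fhc//.
  exact: vahlen_zero (cd q Uq) (det q) (frd q Uq).
have diff q (Uq : U q) : exists m l, [/\ normed (c q) m, normed (d q) l &
    [/\ vec (frhat q - fr q) \is a GRing.unit,
        (vec (frhat q - fr q))^-1 = c q * transp (d q),
        vec (frhat q - fr q) = (transp (d q))^-1 * (c q)^-1 &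
        vec (frhat q - fr q) = (transp (c q))^-1 * (d q)^-1]].
  have [m cm] := Gamma_normed (Gc q Uq); have [l dl] := Gamma_normed (Gd q Uq).
  by exists m, l; split=> //; exact: darboux_difference cm dl (cd q Uq) (gcd q Uq).
have sandwich_neq0 u m (k : R) v w : normed u m -> k != 0 -> v != 0 ->
    vec w = k *: ((transp u)^-1 * vec v * u^-1) :> clifford R n -> w != 0.
  move=> um k0 v0 wE; apply: contra_neq v0 => w0.
  have [uU tuU] := normed_unit um.
  move/eqP: wE; rewrite w0 linear0 eq_sym scaler_eq0 (negbTE k0) /= => /eqP e.
  rewrite -(vecK v) (_ : vec v = 0) ?linear0//.
  have := congr1 (fun x => transp u * x * u) e.
  by rewrite mulr0 mul0r -mulrA divrK// mulVKr.
(* At a point where [Q] does not vanish df^c is nonzero, and so is df; the injective sandwich maps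
   then make both endpoint maps nonconstant. *)
have [p Up np] := hQU; have [i ip] := dom_cover p.
split.
- split.
    split=> //.
    + have [m dm] := Gamma_normed (Gd p Up).
      apply: (nonconstant_dif (X := (1, 0)) hU Up ip).
      exact: sandwich_neq0 dm (oner_neq0 _) (conformal_dif_neq0 hfU.1 ip Up) (dif_fr i p _ ip Up).
    + have [m cm] := Gamma_normed (Gc p Up).
      have [X fcX] := christoffel_dif_neq0 hfU.2 ip Up np.
      apply: (nonconstant_dif (X := X) hU Up ip).
      exact: sandwich_neq0 cm Nr0 fcX (dif_fh i p _ ip Up).
    + move=> q Uq; apply/eqP => g0; have /eqP := gcd q Uq.
      by rewrite g0 linear0 mul0r eq_sym oner_eq0.
  move=> {p Up np i ip} i p ip Up g X Y.
  have [m [l [cm dl [gU gV _ _]]]] := diff p Up.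
  have [cU tcU] := normed_unit cm; have [_ dV tdV] := normed_inv dl.
  have w0 := (cfc i p ip Up).1 X Y.
  have E1 Z : cdif i fr p Z = (l^-1 * l^-1) *: (d p * vec (dif i f p Z) * transp (d p)).
    rewrite /cdif (dif_fr i p Z ip Up) scale1r dV tdV.
    by rewrite -!scalerAl -!scalerAr !scalerA.
  (* Using g^-1 = d c^t on the left and g^-1 = c d^t on the right cancels c^-t and c^-1, leaving a
     sandwich by [d] as in [E1]. *)
  have E2 Z : g^-1 * cdif i frhat p Z * g^-1 =
      (- r) *: (d p * vec (dif i fc p Z) * transp (d p)).
    rewrite /g gV /cdif (dif_fh i p Z ip Up) -!scalerAr -!scalerAl; congr (_ *: _).
    by rewrite {1}cd// -!mulrA mulKr// mulVKr.
  exact: normed_sandwich_wedge dl (E1 X) (E1 Y) (E2 X) (E2 Y) w0.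
- pose U' := U `&` [set p | nonvanishing_at Q p].
  have U'U : U' `<=` U by move=> q [].
  have oU' : open U' by apply: openI => //; exact: open_nonvanishing.
  have hfU' : isothermic_with U' Q fc f.
    apply: christoffel_dual => [|q []//]; split; split.
    + exact: smooth_on_sub U'U sf.
    + by move=> j q jq /U'U; exact: cf.
    + exact: smooth_on_sub U'U sfc.
    + by move=> j q jq /U'U; exact: cfc.
  move=> q U'q.
  (* The structure equation dc = d (r df^c) makes r d the factor [e'] for the frame [c], and k = - r
     is the scalar in dfhat_r. *)
  have [|||||V [hc [oV Vp VU ihc vhc]]] := @isothermic_frame R n M U' Q q (- r) c
      (fun q => r *: d q) fc f frhat oU' U'q Nr0 _ _ _ hfU'.
  + by move=> q' /U'U; exact: Gc.
  + exact: smooth_on_sub U'U sc.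
  + exact: smooth_on_sub U'U sfh.
  + move=> j q' X jq _; have [_ _ -> _] := dF j q' X jq.
    by rewrite -scalerAr scalerAl.
  + by move=> j q' X jq /U'U; exact: dif_fh.
  by exists V; split => //; exists hc.
- move=> q Uq; have [V [hc [oV Vq VU ihc vhc]]] := locfr q Uq.
  exists V; split => //; split => //; first exact: smooth_on_sub VU sfh.
  exists hc; split => // j q' jq Vq' g X.
  have Uq' := VU q' Vq'.
  have [m [l [cm dl [gU gV gE gE']]]] := diff q' Uq'.
  have [dU tdU] := normed_unit dl.
  have -> : cdif j (fun q => frhat q - fr q) q' X = cdif j frhat q' X - cdif j fr q' X.
    rewrite /cdif -linearB; congr vec.
    apply: deriveB; apply: diff_derivable.
      exact: smooth_on_differentiable sfh jq Uq'.
    exact: smooth_on_differentiable sfr jq Uq'.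
  (* With g = c^-t d^-1 on the left and g = d^-t c^-1 on the right, g (d df^c d^t) g collapses to
     c^-t df^c c^-1. *)
  congr (_ - _); rewrite /cdif (dif_fh j q' X jq Uq') (vhc j q' X jq Vq').
  congr (_ *: _); rewrite {1}/g gE' /g gE -!mulrA mulKr//; congr (_ * (_ * _)).
  by rewrite mulVKr.
Qed.
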